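(* For every $1$-Lipschitz map $T:\mathbb{R}^n\to\mathbb{R}^n$ (with respect to the Euclidean norm), every $\mathbb{R}^n$-valued random vector $X$, and every $s>0$, $$h(X+\sqrt{s}\,Z)\;\ge\;h(T(X)+\sqrt{s}\,Z),$$ where the assertion includes that the integrals defining both entropies exist (possibly with value $+\infty$).
   Context: $Z$ denotes a standard Gaussian random vector in $\mathbb{R}^n$, with density $(2\pi)^{-n/2}e^{-\|x\|_2^2/2}$. All sums of random vectors are sums of independent random vectors; thus $Z$ is independent of $X$ and of $T(X)$. The law of $X$ is arbitrary. For a random vector $W$ with density $f$ with respect to Lebesgue measure, the Shannon–Boltzmann entropy is $h(W)=-\int_{\mathbb{R}^n} f\log f\,dx$, if this integral exists. *)

(* Defs.v *)
From HB Require Import structures.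
From mathcomp Require Import all_boot all_order all_algebra.
From mathcomp Require Import all_classical all_reals all_analysis.
From mathcomp Require Import measurable_realfun.

Set Implicit Arguments.
Unset Strict Implicit.
Unset Printing Implicit Defensive.

Import Order.TTheory GRing.Theory Num.Theory.
Import numFieldNormedType.Exports.

Local Open Scope classical_set_scope.
Local Open Scope ring_scope.

(* R^n is represented by n.-tuple R, which carries the product (= Borel)
   sigma-algebra.  It is not given the structure of a normed module: the norm
   that the library puts on row vectors is the sup norm, not the Euclidean
   one. *)

Section euclidean_space.
Context {R : realType} {n : nat}.
Implicit Types x y : n.-tuple R.

Definition vadd x y : n.-tuple R := [tuple tnth x i + tnth y i | i < n].

Definition vsub x y : n.-tuple R := [tuple tnth x i - tnth y i | i < n].

Definition vscale (a : R) x : n.-tuple R := [tuple a * tnth x i | i < n].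

Definition enorm x : R := Num.sqrt (\sum_(i < n) tnth x i ^+ 2).

Definition one_lipschitz (T : n.-tuple R -> n.-tuple R) : Prop :=
  forall x y, enorm (vsub (T x) (T y)) <= enorm (vsub x y).

End euclidean_space.

Lemma product_sigma_finite d1 d2 (T1 : measurableType d1)
    (T2 : measurableType d2) (R : realType)
    (m1 : {sigma_finite_measure set T1 -> \bar R})
    (m2 : {sigma_finite_measure set T2 -> \bar R}) :
  sigma_finite setT (m1 \x m2)%E.
Proof.
have /sigma_finiteP[F [TF ndF Foo]] := sigma_finiteT m1.
have /sigma_finiteP[G [TG ndG Goo]] := sigma_finiteT m2.
exists (fun n => F n `*` G n) => [|k].
  rewrite -setXTT TF TG predeqE => -[x y]; split.
    move=> [/= [n _ Fnx] [k _ Gky]]; exists (maxn n k) => //; split.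
    - by move: x Fnx; exact/subsetPset/ndF/leq_maxl.
    - by move: y Gky; exact/subsetPset/ndG/leq_maxr.
  by move=> [n _ []/= ? ?]; split; exists n.
have [? ?] := Foo k; have [? ?] := Goo k.
split; first exact: measurableX.
by rewrite product_measure1E// lte_mul_pinfty// ge0_fin_numE.
Qed.

Lemma pushforward_sigma_finite_ex d1 d2 (T1 : measurableType d1)
    (T2 : measurableType d2) (R : realType)
    (nu : {measure set T1 -> \bar R}) (f : T1 -> T2)
    (g : T2 -> T1) :
  sigma_finite setT nu ->
  measurable_fun setT f -> measurable_fun setT g -> cancel f g ->
  exists mu : {sigma_finite_measure set T2 -> \bar R}, pushforward nu f = mu.
Proof.
move=> [F FT Ffin] mf mg fK; pose rho := pushforward nu f.
have sf : sigma_finite setT rho.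
  exists (fun k => g @^-1` F k) => [|k].
    by rewrite -preimage_bigcup -FT preimage_setT.
  have [mF Fk] := Ffin k; split.
  - by rewrite -[X in measurable X]setTI; exact: mg.
  - rewrite /rho /pushforward -comp_preimage.
    by rewrite (_ : g \o f = id) ?preimage_id//; apply/funext => p /=.
pose mrho : {measure set T2 -> \bar R} :=
  measure_function_pushforward__canonical__measure_function_Measure nu mf.
pose mS := @Measure_isSigmaFinite.Build _ _ _ mrho sf.
pose S := HB.pack_for (SigmaFiniteMeasure.type T2 R) (Measure.sort mrho) mS.
by exists S.
Qed.

Section lebesgue_tuple.
Local Open Scope ereal_scope.
Context {R : realType}.

Definition tuple_cons n (p : measurableTypeR R * n.-tuple R) : n.+1.-tuple R :=
  [the n.+1.-tuple R of p.1 :: p.2].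

(* Lebesgue measure on R^n; R^0 is a point of mass 1. *)
Fixpoint lebesgue_tuple (n : nat) : set (n.-tuple R) -> \bar R :=
  match n with
  | 0 => \d_([tuple] : 0.-tuple R)
  | m.+1 =>
      pushforward (@lebesgue_measure R \x lebesgue_tuple (n := m))
                  (@tuple_cons m)
  end.
Arguments lebesgue_tuple : clear implicits.

Lemma measurable_tuple_cons n : measurable_fun setT (@tuple_cons n).
Proof. by apply: (@measurable_cons _ _ _ R). Qed.


Let lebesgue_tuple_ex n :
  exists mu : {sigma_finite_measure set (n.-tuple R) -> \bar R},
    lebesgue_tuple n = mu.
Proof.
elim: n => [|n [mu muE]]; first by exists (\d_([tuple] : 0.-tuple R)).
have /= -> := congr1 (fun nu => pushforward (@lebesgue_measure R \x nu)
  (@tuple_cons n)) muE.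
pose uncons (t : n.+1.-tuple R) : measurableTypeR R * n.-tuple R :=
  (thead t, [tuple of behead t]).
have muncons : measurable_fun setT uncons.
  apply/measurable_fun_pairP; split.
  - exact: (@measurable_tnth _ R n.+1 ord0).
  - exact: (@measurable_behead _ R n).
have tuple_consK : cancel (@tuple_cons n) uncons.
  case=> a t; rewrite /uncons /tuple_cons/=; congr (_, _); exact/val_inj.
exact: (@pushforward_sigma_finite_ex _ _ _ _ _ _ _ uncons
  (product_sigma_finite _ mu) (@measurable_tuple_cons n) muncons tuple_consK).
Qed.

Let lebesgue_tuple0 n : lebesgue_tuple n set0 = 0.
Proof. by have [mu ->] := lebesgue_tuple_ex n. Qed.

Let lebesgue_tuple_ge0 n A : 0 <= lebesgue_tuple n A.
Proof. by have [mu ->] := lebesgue_tuple_ex n. Qed.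

Let lebesgue_tuple_sigma_additive n : semi_sigma_additive (lebesgue_tuple n).
Proof.
have [mu ->] := lebesgue_tuple_ex n; exact: measure_semi_sigma_additive.
Qed.

HB.instance Definition _ n := isMeasure.Build _ _ _ (lebesgue_tuple n)
  (lebesgue_tuple0 n) (lebesgue_tuple_ge0 (n := n))
  (@lebesgue_tuple_sigma_additive n).

Let lebesgue_tuple_sigma_finite n : sigma_finite setT (lebesgue_tuple n).
Proof. have [mu ->] := lebesgue_tuple_ex n; exact: sigma_finiteT. Qed.

HB.instance Definition _ n := Measure_isSigmaFinite.Build _ _ _
  (lebesgue_tuple n) (@lebesgue_tuple_sigma_finite n).

Lemma lebesgue_tuple_box n (A : 'I_n -> set (measurableTypeR R)) :
  (forall i, measurable (A i)) ->
  lebesgue_tuple n [set x | forall i, A i (tnth x i)] =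
  \prod_(i < n) lebesgue_measure (A i).
Proof.
elim: n A => [|n ih] A mA.
  by rewrite big_ord0 /= diracE mem_set// => -[].
rewrite big_ord_recl /= /pushforward.
rewrite -(ih (fun i => A (lift ord0 i))) => [|i]; last exact: mA.
have [mu muE] := lebesgue_tuple_ex n; rewrite muE -product_measure1E//.
  congr (product_measure1 _ _ _); apply/seteqP; split => -[a t] /=.
    move=> h; split; first exact: (h ord0).
    by move=> i; have := h (lift ord0 i); rewrite tnthS.
  move=> [Aa At] i; case: (unliftP ord0 i) => [j ->|->//].
  by rewrite tnthS.
rewrite (_ : mkset _ =
    \bigcap_(i in [set: 'I_n]) ((@tnth n R ^~ i) @^-1` (A (lift ord0 i)))).
  apply: fin_bigcap_measurable => // i _.
  by rewrite -[X in measurable X]setTI; apply: (@measurable_tnth _ R n i) => //; exact: mA.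
by apply/seteqP; split => x h i /= => [_|]; exact: h.
Qed.

End lebesgue_tuple.
Arguments lebesgue_tuple {R}.

Section random_vectors.
Local Open Scope ereal_scope.
Context {R : realType} {d : measure_display} {Omega : measurableType d}.
Variable P : probability Omega R.

Definition independent_vectors n (X Y : Omega -> n.-tuple R) : Prop :=
  forall A B : set (n.-tuple R), measurable A -> measurable B ->
    P (X @^-1` A `&` Y @^-1` B) = P (X @^-1` A) * P (Y @^-1` B).

Definition has_density n (W : Omega -> n.-tuple R) (f : n.-tuple R -> R) :
    Prop :=
  [/\ measurable_fun setT W, measurable_fun setT f,
      forall x, (0 <= f x)%R &
      forall A, measurable A ->
        P (W @^-1` A) = \int[lebesgue_tuple n]_(x in A) (f x)%:E].

Definition gaussian_density n (x : n.-tuple R) : R :=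
  ((2 * pi) `^ (- n%:R / 2) * expR (- enorm x ^+ 2 / 2))%R.

Definition standard_gaussian n (Z : Omega -> n.-tuple R) : Prop :=
  has_density Z (@gaussian_density n).

End random_vectors.

Section entropy.
Local Open Scope ereal_scope.
Context {R : realType}.

(* Existence of an integral in the extended sense: the positive and the
   negative part are not both of infinite integral. *)
Definition integral_exists d (T : measurableType d) (mu : set T -> \bar R)
    (g : T -> \bar R) : Prop :=
  measurable_fun setT g /\
  (\int[mu]_x g^\+ x < +oo \/ \int[mu]_x g^\- x < +oo).

(* ln 0 = 0, so the integrand vanishes where f does. *)
Definition flogf n (f : n.-tuple R -> R) (x : n.-tuple R) : \bar R :=
  (f x * ln (f x))%:E.

Context {d : measure_display} {Omega : measurableType d}.
Variable P : probability Omega R.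

Definition entropy_exists n (W : Omega -> n.-tuple R) : Prop :=
  (exists f, has_density P W f) /\
  forall f, has_density P W f -> integral_exists (lebesgue_tuple n) (flogf f).

(* The chosen density does not matter, see entropyE; without a density the
   value is meaningless. *)
Definition entropy n (W : Omega -> n.-tuple R) : \bar R :=
  - \int[lebesgue_tuple n]_x flogf (xget (fun=> 0%R) (has_density P W)) x.

Lemma measurable_flogf n (f : n.-tuple R -> R) :
  measurable_fun setT f -> measurable_fun setT (flogf f).
Proof.
move=> mf; apply/measurable_EFinP; apply: measurable_funM => //.
exact: (measurableT_comp (@measurable_ln R)).
Qed.

Lemma density_unique n (W : Omega -> n.-tuple R) f g :
  has_density P W f -> has_density P W g ->
  ae_eq (lebesgue_tuple n) setT (EFin \o f) (EFin \o g).
Proof.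
move=> [_ mf f0 fE] [_ mg g0 gE].
apply: integral_ae_eq => //.
- apply/integrableP; split; first exact/measurable_EFinP.
  rewrite (eq_integral (fun x => (f x)%:E)) => [|x _]; last first.
    by rewrite /= ger0_norm.
  by rewrite -fE// preimage_setT probability_setT ltry.
- exact/measurable_EFinP.
- by move=> A _ mA; rewrite -fE// gE.
Qed.

Lemma entropyE n (W : Omega -> n.-tuple R) f :
  has_density P W f -> entropy W = - \int[lebesgue_tuple n]_x flogf f x.
Proof.
move=> Wf; rewrite /entropy.
have Wg : has_density P W (xget (fun=> 0%R) (has_density P W)).
  exact: (xgetPex _ (ex_intro _ f Wf)).
move: (xget _ _) Wg => g Wg; congr (- _).
have [_ mf _ _] := Wf; have [_ mg _ _] := Wg.
apply: ae_eq_integral => //; try exact: measurable_flogf.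
apply: filterS (density_unique Wg Wf) => x /= /(_ Logic.I)[gf] _.
by rewrite /flogf gf.
Qed.

End entropy.

(* Main.v *)
Require Import Defs.
From HB Require Import structures.
From mathcomp Require Import all_boot all_order all_algebra.
From mathcomp Require Import all_classical all_reals all_analysis.
From mathcomp Require Import measurable_realfun.
From mathcomp Require Import ring lra.
Set Implicit Arguments.
Unset Strict Implicit.
Unset Printing Implicit Defensive.

Import Order.TTheory GRing.Theory Num.Theory.
Import numFieldNormedType.Exports.

Local Open Scope classical_set_scope.
Local Open Scope ring_scope.

(** The entropy of [X + sqrt s Z] is, up to an additive constant that depends
    only on [n] and [s], the mutual information between [X] and [X + sqrt s Z]
    ([entropy_noisy]).  So the theorem says that a Gaussian observation of a
    contraction [v] of a signal [u] is less informative than a Gaussian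
    observation of [u] itself ([gaussian_information_contraction]).

    Suppose first that [u] and [v] are bounded, and observe simultaneously [u]
    at the signal-to-noise ratio [a] and [v] at the ratio [b], with independent
    noises.  The path [(a, b) = (1 - t, t)] goes from an observation of [u]
    alone to one of [v] alone, and information decreases along it, for the
    following reason.  Since Gaussian laws are stable, raising a ratio by [dt]
    amounts to one more independent observation at the ratio [dt], and by the
    chain rule its contribution is the average, over the posterior laws given
    the other observations, of the information in a single weak observation
    ([information_observe]).  To first order in [dt] that information is
    [dt / 2] times the variance of the signal, whatever its law: the variance
    bounds it from above, by comparison of the law of the observation with the
    Gaussian law of the same mean, and the defect is at most the chi-square
    divergence between these two laws, an explicit Gaussian integral of order
    [dt ^ 2] ([gaussian_information_small_contraction]).  The variance is half
    the mean squared distance between two independent copies, so it is smaller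
    for [v] than for [u] under every law.  Hence replacing a weak observation of
    [u] by one of [v] gains information at most [C * dt ^ 2]; cutting
    the path into [N] steps leaves a total error [C / N].  No derivative and no
    integration by parts is involved.

    For arbitrary signals, condition on the event that [u] and [v] are bounded
    by [N].  The information on [u], times the probability of the event, is at
    most the full information, because the average divergence to a mixture is
    minimal ([integral_kappa_compensation]); the information on [v] is
    recovered as [N] grows by Fatou's lemma.

    Informations are written as integrals of the nonnegative function [kappa],
    so that they make sense, possibly as [+oo], without any integrability
    condition, and their integrals may be exchanged. *)

(** * Measures with a density *)

Section density.
Local Open Scope ereal_scope.
Context d (T : measurableType d) (R : realType).
Import HBNNSimple.

Lemma ge0_integral_density (mu nu : {measure set T -> \bar R}) (f : T -> R)
    (F : T -> \bar R) :
  measurable_fun setT f -> (forall x, 0 <= f x)%R ->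
  (forall A, measurable A -> nu A = \int[mu]_(x in A) (f x)%:E) ->
  measurable_fun setT F -> (forall x, 0 <= F x) ->
  \int[nu]_x F x = \int[mu]_x (F x * (f x)%:E).
Proof.
move=> mf f0 nuE mF F0.
(* Both sides are limits along simple functions increasing to F. *)
pose F_ := nnsfun_approx measurableT mF.
have cvgF x : (F_ n x)%:E @[n --> \oo] --> F x by exact: cvg_nnsfun_approx.
have ndF x : {homo (fun n => F_ n x) : m n / (m <= n)%N >-> (m <= n)%R}.
  by move=> m n mn; exact/lefP/nd_nnsfun_approx.
transitivity (limn (fun n => \int[nu]_x (F_ n x)%:E)).
  rewrite -monotone_convergence//.
  - by apply: eq_integral => y _; exact/esym/cvg_lim.
  - by move=> n; exact/measurable_EFinP/measurable_funP.
  - by move=> n y _; rewrite lee_fin.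
  - by move=> y _ m n mn; rewrite lee_fin ndF.
rewrite [X in limn X](_ : _ =
    (fun n => \int[mu]_x ((F_ n x)%:E * (f x)%:E))).
  rewrite -monotone_convergence//; last 3 first.
  - move=> n; apply: emeasurable_funM; apply/measurable_EFinP => //.
  - by move=> n x _; rewrite mule_ge0// lee_fin.
  - by move=> x _ m n mn; rewrite lee_wpmul2r// lee_fin// ndF.
  apply: eq_integral => x _; apply/cvg_lim => //.
  by apply: cvgeZr => //; exact: cvgF.
apply/funext => n.
transitivity (\sum_(k \in range (F_ n))
    \int[nu]_x (k * \1_(F_ n @^-1` [set k]) x)%:E).
  under eq_integral do rewrite fimfunE -fsumEFin//.
  rewrite ge0_integral_fsum//.
  - by move=> y; exact/measurable_EFinP/measurable_funM.
  - by move=> y x _; rewrite nnfun_muleindic_ge0.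
transitivity (\sum_(k \in range (F_ n))
    \int[mu]_x ((k * \1_(F_ n @^-1` [set k]) x)%:E * (f x)%:E)).
  apply: eq_fsbigr => r; rewrite inE /= => -[x0 _ rE].
  have r0 : (0 <= r)%R by rewrite -rE.
  under eq_integral do rewrite EFinM.
  under [RHS]eq_integral do rewrite EFinM -muleA.
  have mi : measurable_fun setT (fun x => (\1_(F_ n @^-1` [set r]) x : R)%:E).
    exact/measurable_EFinP.
  rewrite ge0_integralZl_EFin//.
  rewrite ge0_integralZl_EFin//; last 2 first.
  - by move=> x _; rewrite mule_ge0// lee_fin.
  - by apply: emeasurable_funM => //; exact/measurable_EFinP.
  congr (_ * _); rewrite integral_indic//= setIT nuE// integral_mkcond.
  apply: eq_integral => x _; rewrite indicE /patch.
  by case: ifPn => _; rewrite ?mul1e ?mul0e.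
rewrite -ge0_integral_fsum//.
- apply: eq_integral => x _; rewrite fimfunE -fsumEFin// -ge0_mule_fsuml//.
  by move=> r; rewrite nnfun_muleindic_ge0.
- move=> r; apply: emeasurable_funM; apply/measurable_EFinP => //.
  exact/measurable_funM.
- by move=> r x _; rewrite mule_ge0 ?lee_fin// -?lee_fin ?nnfun_muleindic_ge0.
Qed.

(** A nonnegative function of integral [1] is the density of a probability
    measure. *)
Lemma probability_density (mu : {measure set T -> \bar R}) (f : T -> R) :
  measurable_fun setT f -> (forall x, 0 <= f x)%R ->
  \int[mu]_x (f x)%:E = 1 ->
  exists Q : probability T R, forall F : T -> \bar R,
    measurable_fun setT F -> (forall x, 0 <= F x) ->
    \int[Q]_x F x = \int[mu]_x (F x * (f x)%:E).
Proof.
move=> mf f0 f1; pose q A := \int[mu]_(x in A) (f x)%:E.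
have q0 : q set0 = 0 by rewrite /q integral_set0.
have qge0 A : 0 <= q A by apply: integral_ge0 => x _; rewrite lee_fin.
have qadd : semi_sigma_additive q.
  move=> /= A mA tA mUA; rewrite /q ge0_integral_bigcup//=.
  - by apply: is_cvg_ereal_nneg_natsum_cond => n _ _; exact: qge0.
  - by apply/measurable_EFinP; exact: measurable_funTS.
  - by move=> x _; rewrite lee_fin.
pose mq := isMeasure.Build _ _ _ q q0 qge0 qadd.
pose M : {measure set T -> \bar R} := HB.pack q mq.
have M1 : M setT = 1 by [].
pose mQ := @Measure_isProbability.Build _ _ R M M1.
pose Q : probability T R := HB.pack (Measure.sort M) mQ.
by exists Q => F mF F0; exact: ge0_integral_density.
Qed.

End density.

(** * Affine changes of variable on the real line *)

Section lebesgue_affine.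
Local Open Scope ereal_scope.
Context {R : realType}.
Local Notation lambda := (@lebesgue_measure R).

Lemma measurable_affine (c a : R) :
  measurable_fun setT (fun x : measurableTypeR R => (c * x + a)%R : measurableTypeR R).
Proof. by apply: measurable_funD => //; exact: measurable_funM. Qed.

Lemma ge0_integral_lebesgue_affine (c a : R) (F : measurableTypeR R -> \bar R) :
  c != 0%R -> measurable_fun setT F -> (forall x, 0 <= F x) ->
  \int[lambda]_x (F (c * x + a)%R * `|c|%:E) = \int[lambda]_x F x.
Proof.
move=> c0 mF F0.
have maff := measurable_affine c a.
pose aff (x : measurableTypeR R) : measurableTypeR R := (c * x + a)%R.
pose p : {measure set (measurableTypeR R) -> \bar R} :=
  measure_function_pushforward__canonical__measure_function_Measure lambda maff.
pose M := mscale (NngNum (normr_ge0 c)) p.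
(* Lebesgue measure is determined by its values on half-open intervals. *)
have ME A : measurable A -> lambda A = M A.
  apply: (@lebesgue_measure_unique R M).
  move=> _ [[x y]] _ <- /=.
  rewrite /M /mscale/= /pushforward -/aff.
  have [cn|cp|cE] := ltgtP c 0%R; last by rewrite cE eqxx in c0.
  - have -> : aff @^-1` `]x, y] = `[((y - a) / c)%R, ((x - a) / c)%R[%classic.
      apply/seteqP; split => z /=; rewrite !in_itv/= /aff.
        by move=> /andP[? ?]; rewrite ler_ndivrMr// ltr_ndivlMr//; lra.
      by rewrite ler_ndivrMr// ltr_ndivlMr// => /andP[? ?]; lra.
    rewrite !lebesgue_measure_itv/= !lte_fin ltr_nM2r ?invr_lt0// ltrD2r.
    case: ifPn => _; last by rewrite mule0.
    by rewrite ltr0_norm//= -!EFinD -EFinM; congr (_%:E); field.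
  - have -> : aff @^-1` `]x, y] = `]((x - a) / c)%R, ((y - a) / c)%R]%classic.
      apply/seteqP; split => z /=; rewrite !in_itv/= /aff.
        by move=> /andP[? ?]; rewrite ltr_pdivrMr// ler_pdivlMr//; lra.
      by rewrite ltr_pdivrMr// ler_pdivlMr// => /andP[? ?]; lra.
    rewrite !lebesgue_measure_itv/= !lte_fin ltr_pM2r ?invr_gt0// ltrD2r.
    case: ifPn => _; last by rewrite mule0.
    by rewrite gtr0_norm//= -!EFinD -EFinM; congr (_%:E); field.
transitivity (\int[M]_x F x).
  rewrite ge0_integral_mscale//= ge0_integral_pushforward//.
  rewrite preimage_setT ge0_integralZr//.
  - by rewrite muleC.
  - by apply: measurableT_comp.
apply: eq_measure_integral => A mA _; exact/esym/ME.
Qed.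

End lebesgue_affine.

(** * Euclidean space and Lebesgue measure on tuples *)

(** The Euclidean inner product. *)
Definition dot (R : realType) n (x y : n.-tuple R) : R :=
  \sum_(i < n) tnth x i * tnth y i.

Section tuple_algebra.
Context {R : realType} {n : nat}.
Implicit Types (x y z : n.-tuple R) (a c : R).

Lemma dotC x y : dot x y = dot y x.
Proof. by apply: eq_bigr => i _; rewrite mulrC. Qed.

Lemma dotDl x y z : dot (vadd x y) z = dot x z + dot y z.
Proof.
by rewrite /dot -big_split/=; apply: eq_bigr => i _; rewrite tnth_mktuple mulrDl.
Qed.

Lemma dotBl x y z : dot (vsub x y) z = dot x z - dot y z.
Proof.
by rewrite /dot -sumrB; apply: eq_bigr => i _; rewrite tnth_mktuple mulrBl.
Qed.

Lemma dotZl a x z : dot (vscale a x) z = a * dot x z.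
Proof.
by rewrite /dot big_distrr/=; apply: eq_bigr => i _; rewrite tnth_mktuple mulrA.
Qed.

Lemma dotDr x y z : dot x (vadd y z) = dot x y + dot x z.
Proof. by rewrite !(dotC x) dotDl. Qed.

Lemma dotBr x y z : dot x (vsub y z) = dot x y - dot x z.
Proof. by rewrite !(dotC x) dotBl. Qed.

Lemma dotZr a x y : dot x (vscale a y) = a * dot x y.
Proof. by rewrite !(dotC x) dotZl. Qed.

(** Expands inner products of linear combinations. *)
Definition dotE := (dotDl, dotDr, dotBl, dotBr, dotZl, dotZr).

Lemma dot_ge0 x : 0 <= dot x x.
Proof. by apply: sumr_ge0 => i _; rewrite -expr2 sqr_ge0. Qed.

Lemma enorm_sq x : enorm x ^+ 2 = dot x x.
Proof.
rewrite /enorm sqr_sqrtr; first by apply: eq_bigr => i _; rewrite expr2.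
by apply: sumr_ge0 => i _; rewrite sqr_ge0.
Qed.

Lemma enorm_ge0 x : 0 <= enorm x.
Proof. exact: sqrtr_ge0. Qed.

Lemma one_lipschitz_dot (T : n.-tuple R -> n.-tuple R) x y : one_lipschitz T ->
  dot (vsub (T x) (T y)) (vsub (T x) (T y)) <= dot (vsub x y) (vsub x y).
Proof. by move=> /(_ x y) Txy; rewrite -!enorm_sq lerXn2r// nnegrE enorm_ge0. Qed.

End tuple_algebra.

Section measurable_tuples.
Context {R : realType} {d} {T : measurableType d} {n : nat}.
Implicit Types f g : T -> n.-tuple R.

Lemma measurable_tnth_comp f i :
  measurable_fun setT f -> measurable_fun setT (fun t => tnth (f t) i).
Proof. by move=> mf; apply: (measurableT_comp (measurable_tnth i)). Qed.

Lemma measurable_vadd f g : measurable_fun setT f -> measurable_fun setT g ->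
  measurable_fun setT (fun t => vadd (f t) (g t)).
Proof.
move=> mf mg; apply/measurable_fun_tnthP => i.
rewrite (_ : _ \o _ = fun t => tnth (f t) i + tnth (g t) i).
  by apply: measurable_funD; exact: measurable_tnth_comp.
by apply/funext => t /=; rewrite tnth_mktuple.
Qed.

Lemma measurable_vscale (a : T -> R) f :
  measurable_fun setT a -> measurable_fun setT f ->
  measurable_fun setT (fun t => vscale (a t) (f t)).
Proof.
move=> ma mf; apply/measurable_fun_tnthP => i.
rewrite (_ : _ \o _ = fun t => a t * tnth (f t) i).
  by apply: measurable_funM => //; exact: measurable_tnth_comp.
by apply/funext => t /=; rewrite tnth_mktuple.
Qed.

Lemma measurable_dot f g : measurable_fun setT f -> measurable_fun setT g ->
  measurable_fun setT (fun t => dot (f t) (g t)).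
Proof.
move=> mf mg; apply: measurable_sum => i.
by apply: measurable_funM; exact: measurable_tnth_comp.
Qed.

End measurable_tuples.

Section lebesgue_tuple_affine.
Local Open Scope ereal_scope.
Context {R : realType}.
Local Notation lambda := (@lebesgue_measure R).

(** Integration over the first coordinate, then over the others. *)
Lemma ge0_integral_lebesgue_tupleS n (F : n.+1.-tuple R -> \bar R) :
  measurable_fun setT F -> (forall x, 0 <= F x) ->
  \int[lebesgue_tuple n.+1]_x F x =
  \int[lebesgue_tuple n]_t \int[lambda]_x F (tuple_cons (x, t)).
Proof.
move=> mF F0; have mc := @measurable_tuple_cons R n.
pose p : {measure set (n.+1.-tuple R) -> \bar R} :=
  measure_function_pushforward__canonical__measure_function_Measure
    (lambda \x lebesgue_tuple n) mc.
transitivity (\int[p]_x F x); first exact: eq_measure_integral.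
rewrite ge0_integral_pushforward// preimage_setT fubini_tonelli2//.
- exact: measurableT_comp.
- by move=> x; exact: F0.
Qed.

Lemma ge0_integral_lebesgue_tuple_affine n (c : R) (a : n.-tuple R)
    (F : n.-tuple R -> \bar R) :
  c != 0%R -> measurable_fun setT F -> (forall x, 0 <= F x) ->
  \int[lebesgue_tuple n]_x (F (vadd (vscale c x) a) * (`|c| ^+ n)%:E) =
  \int[lebesgue_tuple n]_x F x.
Proof.
move=> c0; elim: n a F => [|n IH] a F mF F0.
  rewrite expr0; apply: eq_integral => x _; rewrite mule1; congr F.
  by apply: eq_from_tnth => -[].
have maff m (b : m.-tuple R) : measurable_fun setT (fun x => vadd (vscale c x) b).
  apply: measurable_vadd; last exact: measurable_cst.
  by apply: measurable_vscale; [exact: measurable_cst|exact: measurable_id].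
have mFc : measurable_fun setT (F \o @tuple_cons R n).
  by apply: measurableT_comp => //; exact: measurable_tuple_cons.
rewrite !ge0_integral_lebesgue_tupleS//; last 2 first.
- by apply: emeasurable_funM => //; exact: (measurableT_comp mF (maff _ a)).
- by move=> x; rewrite mule_ge0// lee_fin exprn_ge0.
rewrite -[RHS](IH [tuple of behead a]); last 2 first.
- exact: (measurable_fun_fubini_tonelli_G (m1 := lambda) _ mFc (fun=> F0 _)).
- by move=> t; exact: integral_ge0.
apply: eq_integral => t _.
(* The first coordinate is a one-dimensional change of variable, the others
   are left to the induction hypothesis. *)
pose t' := vadd (vscale c t) [tuple of behead a].
rewrite -[X in _ = X * _](@ge0_integral_lebesgue_affine R c (thead a)
  (fun x => F (tuple_cons (x, t')))) //; last exact: (measurable_fun_pair1 t' mFc).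
rewrite -ge0_integralZr//=; last 2 first.
- apply: emeasurable_funM => //.
  apply: (@measurableT_comp _ _ _ _ _ _ (F \o @tuple_cons R n)
    _ (fun x : measurableTypeR R => ((c * x + thead a)%R, t'))) => //.
  by apply/measurable_fun_pairP; split => /=;
    [exact: measurable_affine|exact: measurable_cst].
- by move=> x _; rewrite mule_ge0// lee_fin.
apply: eq_integral => x _; rewrite exprS EFinM muleA; congr (F _ * _ * _).
apply: eq_from_tnth => i; rewrite !tnth_mktuple.
have [j ->|->] := unliftP ord0 i; rewrite /tuple_cons/=.
- rewrite !tnthS !tnth_mktuple; congr (_ + _)%R.
  by rewrite (tnth_nth 0%R) [in RHS](tnth_nth 0%R)/= nth_behead.
- by rewrite !tnth0.
Qed.

End lebesgue_tuple_affine.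

(** * The standard Gaussian measure *)

(** The density of the translate by [a] of the standard Gaussian measure, with
    respect to the standard Gaussian measure itself. *)
Definition tilt (R : realType) n (a z : n.-tuple R) : R :=
  expR (dot a z - dot a a / 2).

(** [G] is the standard Gaussian measure: it has the density
    [gaussian_density].  This is stated on integrals of nonnegative functions
    rather than on measures of sets. *)
Definition gaussian_measure (R : realType) n (G : probability (n.-tuple R) R) :=
  forall F : n.-tuple R -> \bar R, measurable_fun setT F ->
    (forall x, 0 <= F x)%E ->
    (\int[G]_x F x = \int[lebesgue_tuple n]_x (F x * (gaussian_density x)%:E))%E.

Section gaussian.
Context {R : realType} {n : nat}.
Implicit Types (a b c w x y z : n.-tuple R).

Lemma tilt_gt0 a z : 0 < tilt a z.
Proof. exact: expR_gt0. Qed.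

Lemma tilt_ge0 a z : 0 <= tilt a z.
Proof. exact: expR_ge0. Qed.

Lemma measurable_tilt d (T : measurableType d) (f g : T -> n.-tuple R) :
  measurable_fun setT f -> measurable_fun setT g ->
  measurable_fun setT (fun t => tilt (f t) (g t)).
Proof.
move=> mf mg; apply: measurableT_comp => //; apply: measurable_funB.
  exact: measurable_dot.
by apply: measurable_funM => //; exact: measurable_dot.
Qed.

Lemma gaussian_densityE x :
  gaussian_density x = (2 * pi) `^ (- n%:R / 2) * expR (- dot x x / 2).
Proof. by rewrite /gaussian_density enorm_sq. Qed.

Lemma gaussian_density_gt0 x : 0 < gaussian_density x.
Proof. by rewrite mulr_gt0 ?expR_gt0// powR_gt0// mulr_gt0// pi_gt0. Qed.

Lemma gaussian_density_ge0 x : 0 <= gaussian_density x.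
Proof. exact/ltW/gaussian_density_gt0. Qed.

Lemma measurable_gaussian_density d (T : measurableType d) (f : T -> n.-tuple R) :
  measurable_fun setT f -> measurable_fun setT (fun t => gaussian_density (f t)).
Proof.
move=> mf; under eq_fun do rewrite gaussian_densityE.
apply: measurable_funM => //; apply: measurableT_comp => //.
by apply: measurable_funM => //; apply: measurable_funN; exact: measurable_dot.
Qed.

Lemma gaussian_density_vsub a z :
  gaussian_density (vsub z a) = gaussian_density z * tilt a z.
Proof.
rewrite !gaussian_densityE /tilt -mulrA -expRD; congr (_ * expR _).
by rewrite !dotE (dotC z a); field.
Qed.

Lemma vaddK a z : vsub (vadd z a) a = z.
Proof. by apply: eq_from_tnth => i; rewrite !tnth_mktuple addrK. Qed.

Variable G : probability (n.-tuple R) R.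
Hypothesis gaussG : gaussian_measure G.
Local Open Scope ereal_scope.

(** Tilting by [a] is translating by [a]. *)
Lemma ge0_integral_tilt a (F : n.-tuple R -> \bar R) :
  measurable_fun setT F -> (forall x, 0 <= F x) ->
  \int[G]_z (F z * (tilt a z)%:E) = \int[G]_z F (vadd z a).
Proof.
move=> mF F0.
have mFa : measurable_fun setT (fun z => F (vadd z a)).
  apply: measurableT_comp => //.
  by apply: measurable_vadd; [exact: measurable_id|exact: measurable_cst].
have mt : measurable_fun setT (fun z => (tilt a z)%:E).
  apply/measurable_EFinP.
  by apply: measurable_tilt; [exact: measurable_cst|exact: measurable_id].
have mg : measurable_fun setT (fun z : n.-tuple R => (gaussian_density z)%:E).
  by apply/measurable_EFinP; exact: measurable_gaussian_density.
rewrite !gaussG//; last 2 first.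
- exact: emeasurable_funM.
- by move=> x; rewrite mule_ge0// lee_fin tilt_ge0.
rewrite -(@ge0_integral_lebesgue_tuple_affine R n 1%R a (fun z =>
   F z * (tilt a z)%:E * (gaussian_density z)%:E)) ?oner_eq0//; last 2 first.
- by apply: emeasurable_funM => //; exact: emeasurable_funM.
- by move=> x; rewrite !mule_ge0// lee_fin ?tilt_ge0 ?gaussian_density_ge0.
apply: eq_integral => x _; rewrite normr1 expr1n mule1.
have -> : vscale 1 x = x by apply: eq_from_tnth => i; rewrite tnth_mktuple mul1r.
rewrite -muleA -EFinM; congr (_ * _%:E).
by rewrite mulrC -gaussian_density_vsub vaddK.
Qed.

Lemma integral_tilt a : \int[G]_z (tilt a z)%:E = 1.
Proof.
under eq_integral do rewrite -[X in X%:E]mul1r EFinM.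
rewrite (@ge0_integral_tilt a (cst 1))//.
by rewrite integral_cst// mul1e; exact: probability_setT.
Qed.

Lemma ge0_integral_gaussianN (F : n.-tuple R -> \bar R) :
  measurable_fun setT F -> (forall x, 0 <= F x) ->
  \int[G]_z F (vscale (-1) z) = \int[G]_z F z.
Proof.
move=> mF F0; pose o : n.-tuple R := [tuple 0%R | i < n].
have mFa : measurable_fun setT (fun z => F (vscale (-1) z)).
  apply: measurableT_comp => //.
  by apply: measurable_vscale; [exact: measurable_cst|exact: measurable_id].
have mg : measurable_fun setT (fun z : n.-tuple R => (gaussian_density z)%:E).
  by apply/measurable_EFinP; exact: measurable_gaussian_density.
rewrite !gaussG//.
rewrite -[RHS](@ge0_integral_lebesgue_tuple_affine R n (-1)%R o)
  ?oppr_eq0 ?oner_eq0//; last 2 first.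
- exact: emeasurable_funM.
- by move=> x; rewrite !mule_ge0// lee_fin ?gaussian_density_ge0.
apply: eq_integral => x _; rewrite normrN normr1 expr1n mule1.
have -> : vadd (vscale (-1) x) o = vscale (-1) x.
  by apply: eq_from_tnth => i; rewrite !tnth_mktuple addr0.
by congr (_ * _%:E); rewrite !gaussian_densityE !dotE; congr (_ * expR _)%R; field.
Qed.

(** Stability of the standard Gaussian measure under rotations of the product:
    a linear combination with unit coefficient vector of two independent
    standard Gaussian vectors is a standard Gaussian vector. *)
Lemma ge0_integral_gaussian_rotation (al be : R) (F : n.-tuple R -> \bar R) :
  (0 < be)%R -> (al ^+ 2 + be ^+ 2 = 1)%R ->
  measurable_fun setT F -> (forall x, 0 <= F x) ->
  \int[G]_y \int[G]_z F (vadd (vscale al y) (vscale be z)) = \int[G]_z F z.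
Proof.
move=> be0 albe mF F0.
have beN0 : be != 0%R by rewrite gt_eqF.
pose g (x : n.-tuple R) : R := gaussian_density x.
have g0 x : 0 <= (g x)%:E by rewrite lee_fin gaussian_density_ge0.
have mg d (T : measurableType d) (f : T -> n.-tuple R) :
    measurable_fun setT f -> measurable_fun setT (fun t => (g (f t))%:E).
  by move=> mf; apply/measurable_EFinP; exact: measurable_gaussian_density.
have msc d (T : measurableType d) (k : R) (f : T -> n.-tuple R) :
    measurable_fun setT f -> measurable_fun setT (fun t => vscale k (f t)).
  by move=> mf; apply: measurable_vscale => //; exact: measurable_cst.
pose sh (k l : R) (x y : n.-tuple R) := vadd (vscale k x) (vscale l y).
have msh d (T : measurableType d) (k l : R) (f h : T -> n.-tuple R) :
    measurable_fun setT f -> measurable_fun setT h ->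
    measurable_fun setT (fun t => sh k l (f t) (h t)).
  by move=> mf mh; apply: measurable_vadd; exact: msc.
have mF2 d (T : measurableType d) (f : T -> n.-tuple R) :
  measurable_fun setT f -> measurable_fun setT (fun t => F (f t)).
  by move=> mf; exact: measurableT_comp.
(* J is the integrand in the variables x = al * y + be * z and y. *)
pose J x y : \bar R := F x * (g y)%:E *
    (g (sh be^-1%R (- (al / be))%R x y))%:E * (`|be^-1| ^+ n)%:E.
have J0 x y : 0 <= J x y by rewrite /J !mule_ge0.
have mJ : measurable_fun setT (fun xy : n.-tuple R * n.-tuple R => J xy.1 xy.2).
  rewrite /J; do 2 (apply: emeasurable_funM => //); last first.
  - by apply: (mg); exact: (msh).
  - by apply: emeasurable_funM; [exact: mF2|exact: mg].
transitivity (\int[lebesgue_tuple n]_y \int[lebesgue_tuple n]_x J x y).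
  have mI : measurable_fun setT (fun y => \int[G]_z F (sh al be y z)).
    apply: (@measurable_fun_fubini_tonelli_F _ _ _ _ R G
      (fun p => F (sh al be p.1 p.2))) => //.
    by apply: (mF2); exact: (msh).
  rewrite gaussG//; last by move=> x; exact: integral_ge0.
  apply: eq_integral => y _; rewrite gaussG//; last first.
    by apply: (mF2); apply: (msh) => //; exact: measurable_cst.
  have mFg : measurable_fun setT (fun z => F (sh al be y z) * (g z)%:E).
    apply: emeasurable_funM; last exact: mg.
    by apply: (mF2); apply: (msh) => //; exact: measurable_cst.
  rewrite -[X in X * _](@ge0_integral_lebesgue_tuple_affine R n be^-1
    (vscale (- (al / be))%R y)) ?invr_eq0//; last first.
    by move=> x; rewrite mule_ge0.
  have mbig : measurable_fun setT (fun x =>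
      F (sh al be y (sh be^-1%R (- (al / be))%R x y)) *
      (g (sh be^-1%R (- (al / be))%R x y))%:E * (`|be^-1| ^+ n)%:E).
    apply: emeasurable_funM => //; apply: emeasurable_funM.
    - apply: (mF2); apply: (msh); first exact: measurable_cst.
      by apply: (msh) => //; exact: measurable_cst.
    - by apply: (mg); apply: (msh) => //; exact: measurable_cst.
  rewrite -ge0_integralZr//; last first.
    by move=> x _; rewrite !mule_ge0.
  apply: eq_integral => x _; rewrite /J.
  have shx : sh al be y (sh be^-1%R (- (al / be))%R x y) = x.
    by apply: eq_from_tnth => i; rewrite !tnth_mktuple; field.
  rewrite -!/(sh _ _ _ _) shx.
  by rewrite -!muleA; congr (_ * _); rewrite [RHS]muleC -!muleA.
have -> : \int[lebesgue_tuple n]_y \int[lebesgue_tuple n]_x J x y = \int[lebesgue_tuple n]_x \int[lebesgue_tuple n]_y J x y.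
  exact: (esym (@fubini_tonelli _ _ _ _ _ (lebesgue_tuple n) (lebesgue_tuple n)
    (fun xy => J xy.1 xy.2) mJ (fun=> J0 _ _))).
rewrite gaussG//; apply: eq_integral => x _.
pose H y : \bar R := (g (sh be^-1%R (- (al / be))%R y x))%:E.
transitivity (\int[lebesgue_tuple n]_y (F x * (g x)%:E * (H y * (`|be^-1| ^+ n)%:E))).
  apply: eq_integral => y _; rewrite /J /H -!muleA; congr (_ * _).
  rewrite !muleA; congr (_ * _); rewrite -!EFinM /g !gaussian_densityE.
  set k := (_ `^ _)%R.
  congr (_%:E); rewrite mulrACA [RHS]mulrACA -!expRD; congr (_ * expR _)%R.
  rewrite !dotE !(dotC y x).
  set p := dot x x; set q := dot x y; set r := dot y y.
  (* The two quadratic forms agree because al ^ 2 + be ^ 2 = 1. *)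
  have bm : (be^-1 * be^-1 = 1 + al / be * (al / be))%R.
    have -> : (be^-1 * be^-1 = (al ^+ 2 + be ^+ 2) / (be * be))%R.
      by rewrite albe; field.
    by field.
  move: bm; move: be^-1%R (al / be)%R => b m bm.
  have -> : (- r / 2 = - p / 2 + (p - r) / 2 * (b * b - m * m))%R.
    by rewrite bm; field.
  by field.
have mH : measurable_fun setT H.
  by apply: (mg); apply: (msh) => //; exact: measurable_cst.
rewrite ge0_integralZl//; last 3 first.
- exact: emeasurable_funM.
- by move=> y _; rewrite mule_ge0// g0.
- by rewrite mule_ge0.
rewrite (@ge0_integral_lebesgue_tuple_affine R n be^-1 (vscale (- (al / be))%R x)
  (fun y => (g y)%:E)) ?invr_eq0//; last exact: mg.
(* The total mass of the Gaussian density is that of G. *)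
have -> : \int[lebesgue_tuple n]_y (g y)%:E = 1; last by rewrite mule1.
transitivity (\int[G]_y (cst 1 y)).
  by rewrite gaussG//; apply: eq_integral => y _; rewrite mul1e.
by rewrite integral_cst// mul1e; exact: probability_setT.
Qed.

End gaussian.

(** * A pointwise relative entropy *)

(** The integrand of the Kullback-Leibler divergence, made nonnegative by the
    terms [- k + g], which disappear upon integrating two densities. *)
Definition kappa (R : realType) (k g : R) : R := k * ln (k / g) - k + g.

Section kappa.
Context {R : realType}.
Implicit Types (c e g k m q t : R).

Lemma kappa_ge0 k g : 0 < k -> 0 < g -> 0 <= kappa k g.
Proof.
move=> k0 g0; rewrite /kappa.
have kg : 0 < g / k by rewrite divr_gt0.
have -> : k / g = (g / k)^-1 by rewrite invf_div.
rewrite lnV ?posrE//.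
have : k * ln (g / k) <= k * (g / k - 1).
  rewrite ler_pM2l//; have := @le_ln1Dx R (g / k - 1).
  by rewrite addrCA subrr addr0; apply; lra.
rewrite mulrBr mulr1 (_ : k * (g / k) = g); first by lra.
by field; rewrite gt_eqF.
Qed.

Lemma kappa_scale c k g : 0 < c -> kappa (c * k) (c * g) = c * kappa k g.
Proof.
move=> c0; rewrite /kappa -mulf_div divff ?gt_eqF// mul1r; move: (ln _) => l; ring.
Qed.

(** The chain rule for divergences, with the linear terms moved so that every
    summand is nonnegative. *)
Lemma kappa_chain k g e m : 0 < k -> 0 < g -> 0 < e -> 0 < m ->
  kappa (k * e) (g * m) + e * g + m * k =
  e * kappa k g + k * kappa e m + e * k + m * g.
Proof.
move=> k0 g0 e0 m0; rewrite /kappa -mulf_div [ln (k / g * _)]lnM ?posrE ?divr_gt0//.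
by move: (ln (k / g)) (ln (e / m)) => l l'; ring.
Qed.

Lemma kappa_three_points e m q : 0 < e -> 0 < m -> 0 < q ->
  kappa e q = kappa e m + e * ln (m / q) - m + q.
Proof.
move=> e0 m0 q0; rewrite /kappa.
have -> : e / q = e / m * (m / q) by rewrite mulrA divfK// gt_eqF.
rewrite [ln (e / m * _)]lnM ?posrE ?divr_gt0//.
by move: (ln (e / m)) (ln (m / q)) => l l'; ring.
Qed.

(** The divergence is bounded by the chi-square divergence. *)
Lemma kappa_le_chi2 k g : 0 < k -> 0 < g -> kappa k g + 2 * k <= k ^+ 2 / g + g.
Proof.
move=> k0 g0; rewrite /kappa.
have kg : 0 < k / g by rewrite divr_gt0.
have : k * ln (k / g) <= k * (k / g - 1).
  rewrite ler_pM2l//; have := @le_ln1Dx R (k / g - 1).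
  by rewrite addrCA subrr addr0; apply; lra.
rewrite mulrBr mulr1 mulrA -expr2; lra.
Qed.

Lemma measurable_kappa d (T : measurableType d) (f h : T -> R) :
  measurable_fun setT f -> measurable_fun setT h -> (forall x, 0 < h x) ->
  measurable_fun setT (fun x => kappa (f x) (h x)).
Proof.
move=> mf mh h0; apply: measurable_funD => //; apply: measurable_funB => //.
apply: measurable_funM => //; apply: (measurableT_comp (@measurable_ln R)).
apply: measurable_funM => //.
rewrite (_ : (fun _ => _) = fun x => h x `^ (-1)).
  exact: (measurableT_comp (measurable_powR (-1))).
by apply/funext => x; rewrite powR_inv1// ltW.
Qed.

(** Some bound on [t] from above is needed; the constants are not optimal. *)
Lemma expR_le_quadratic t : t <= 1 -> expR t <= 1 + t + 2 * t ^+ 2.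
Proof.
move=> t1.
(* exp t is at most 1 / (1 - t / 2) ^ 2. *)
have h : 1 - t / 2 <= expR (- (t / 2)) by have := expR_ge1Dx (- (t / 2)); lra.
have h0 : 0 < 1 - t / 2 by lra.
have h2 : (1 - t / 2) ^+ 2 <= expR (- t).
  have -> : - t = - (t / 2) + - (t / 2) by field.
  by rewrite expRD -expr2 lerXn2r ?nnegrE ?expR_ge0// ltW.
have E0 := expR_gt0 t.
have : expR t * (1 - t / 2) ^+ 2 <= 1.
  by move: h2; rewrite -(ler_pM2l E0) expRxMexpNx_1.
have p0 : 0 < (1 - t / 2) ^+ 2 by rewrite exprn_gt0.
rewrite -ler_pdivlMr// => /le_trans; apply.
rewrite ler_pdivrMr// -subr_ge0.
have -> : (1 + t + 2 * t ^+ 2) * (1 - t / 2) ^+ 2 - 1 =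
  t ^+ 2 * ((1 - t) * (5 / 4 - t / 2)) by field.
by rewrite mulr_ge0 ?sqr_ge0// mulr_ge0; lra.
Qed.

End kappa.

(** * Integrals against a probability measure *)

Lemma adde_fin_inj (R : realDomainType) (c : R) (x y : \bar R) :
  (x + c%:E = y + c%:E -> x = y)%E.
Proof. by move=> xy; rewrite -(@addeK _ c%:E x)// xy addeK. Qed.

Section probability_integrals.
Context d (T : measurableType d) (R : realType).
Variable Q : probability T R.
Implicit Types f g : T -> R.

Lemma integral_probability_cst (c : R) : (\int[Q]_x c%:E = c%:E)%E.
Proof.
rewrite integral_cst// -[RHS]mule1; congr (_ * _)%E; exact: probability_setT.
Qed.

Lemma EFin_Rintegral f : (forall x, 0 <= f x) ->
  (\int[Q]_x (f x)%:E < +oo)%E ->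
  ((\int[Q]_x f x)%:E = \int[Q]_x (f x)%:E)%E.
Proof.
move=> f0 foo; rewrite /Rintegral fineK// ge0_fin_numE//.
by apply: integral_ge0 => x _; rewrite lee_fin.
Qed.

Lemma Rintegral_gt0 f : measurable_fun setT f -> (forall x, 0 < f x) ->
  (\int[Q]_x (f x)%:E < +oo)%E -> 0 < \int[Q]_x f x.
Proof.
move=> mf f0 foo; have f0' x : 0 <= f x by rewrite ltW.
rewrite lt_neqAle Rintegral_ge0// andbT; apply/eqP => I0.
have : (\int[Q]_x `|(f x)%:E| = 0)%E.
  under eq_integral do rewrite /= ger0_norm//.
  by rewrite -EFin_Rintegral// -I0.
move=> /ae_eq_integral_abs => /(_ measurableT).
have mEf : measurable_fun setT (EFin \o f) by exact/measurable_EFinP.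
move=> /(_ mEf)[N [mN N0 sub]].
suff NT : N = setT by have := probability_setT Q; rewrite -NT N0 => /eqP; rewrite eq_sym onee_eq0.
apply/seteqP; split => // x _; apply: sub => /= /(_ I)[fx0].
by have := f0 x; rewrite fx0 ltxx.
Qed.

(** Bounded measurable functions, all of which are integrable. *)
Definition bounded_mfun f :=
  measurable_fun setT f /\ exists M, forall x, `|f x| <= M.

Lemma bounded_mfun_integrable f : bounded_mfun f -> Q.-integrable setT (EFin \o f).
Proof.
move=> [mf [M fM]].
apply: (@le_integrable _ _ _ Q setT measurableT _ (EFin \o cst M)).
- exact/measurable_EFinP.
- by move=> x _ /=; rewrite lee_fin (le_trans (fM x))// ler_norm.
- exact: finite_measure_integrable_cst.
Qed.

Lemma bounded_mfunD f g : bounded_mfun f -> bounded_mfun g ->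
  bounded_mfun (fun x => f x + g x).
Proof.
move=> [mf [M fM]] [mg [N gN]]; split; first exact: measurable_funD.
by exists (M + N) => x; rewrite (le_trans (ler_normD _ _))// lerD.
Qed.

Lemma bounded_mfunM f g : bounded_mfun f -> bounded_mfun g ->
  bounded_mfun (fun x => f x * g x).
Proof.
move=> [mf [M fM]] [mg [N gN]]; split; first exact: measurable_funM.
by exists (M * N) => x; rewrite normrM ler_pM.
Qed.

Lemma bounded_mfun_cst c : bounded_mfun (fun=> c).
Proof. by split; [exact: measurable_cst|exists `|c| => x]. Qed.

Lemma bounded_mfunB f g : bounded_mfun f -> bounded_mfun g ->
  bounded_mfun (fun x => f x - g x).
Proof.
move=> bf bg; have := bounded_mfunD bf (bounded_mfunM (bounded_mfun_cst (-1)) bg).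
by under eq_fun do rewrite mulN1r.
Qed.

Lemma bounded_mfun_sum (I : Type) (s : seq I) (F : I -> T -> R) :
  (forall i, bounded_mfun (F i)) ->
  bounded_mfun (fun x => \sum_(i <- s) F i x).
Proof.
move=> bF; elim: s => [|i s IH].
  by under eq_fun do rewrite big_nil; exact: bounded_mfun_cst.
by under eq_fun do rewrite big_cons; exact: bounded_mfunD.
Qed.

Lemma bounded_Rintegral_cst c : \int[Q]_x c = c.
Proof. by rewrite /Rintegral integral_probability_cst. Qed.

Lemma bounded_RintegralD f g : bounded_mfun f -> bounded_mfun g ->
  \int[Q]_x (f x + g x) = \int[Q]_x f x + \int[Q]_x g x.
Proof. by move=> bf bg; rewrite RintegralD//; exact: bounded_mfun_integrable. Qed.

Lemma bounded_RintegralB f g : bounded_mfun f -> bounded_mfun g ->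
  \int[Q]_x (f x - g x) = \int[Q]_x f x - \int[Q]_x g x.
Proof. by move=> bf bg; rewrite RintegralB//; exact: bounded_mfun_integrable. Qed.

Lemma bounded_RintegralZl c f : bounded_mfun f ->
  \int[Q]_x (c * f x) = c * \int[Q]_x f x.
Proof. by move=> bf; rewrite RintegralZl//; exact: bounded_mfun_integrable. Qed.

Lemma bounded_Rintegral_sum (I : Type) (s : seq I) (F : I -> T -> R) :
  (forall i, bounded_mfun (F i)) ->
  \int[Q]_x (\sum_(i <- s) F i x) = \sum_(i <- s) \int[Q]_x F i x.
Proof.
move=> bF; elim: s => [|i s IH].
  by rewrite big_nil; under eq_Rintegral do rewrite big_nil; exact: bounded_Rintegral_cst.
rewrite big_cons -IH -bounded_RintegralD//; last exact: bounded_mfun_sum.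
by apply: eq_Rintegral => x _; rewrite big_cons.
Qed.

Lemma le_bounded_Rintegral f g : bounded_mfun f -> bounded_mfun g ->
  (forall x, f x <= g x) -> \int[Q]_x f x <= \int[Q]_x g x.
Proof.
by move=> bf bg fg; apply: le_Rintegral => //; exact: bounded_mfun_integrable.
Qed.

Lemma EFin_bounded_Rintegral f : bounded_mfun f ->
  ((\int[Q]_x f x)%:E = \int[Q]_x (f x)%:E)%E.
Proof.
move=> bf; rewrite /Rintegral fineK//.
by apply: integrable_fin_num => //; exact: bounded_mfun_integrable.
Qed.

(** The compensation (Pythagorean) identity: the average divergence of a
    family [e] of densities from [q] exceeds that from their mixture [m] by the
    divergence of [m] from [q]. *)
Lemma integral_kappa_compensation (e : T -> R) (m q : R) :
  measurable_fun setT e -> (forall x, 0 < e x) -> 0 < q -> 0 < m ->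
  (\int[Q]_x (e x)%:E = m%:E)%E ->
  (\int[Q]_x (kappa (e x) m)%:E + (kappa m q)%:E =
   \int[Q]_x (kappa (e x) q)%:E)%E.
Proof.
move=> me e0 q0 m0 Em.
have mk p : 0 < p -> measurable_fun setT (fun x => (kappa (e x) p)%:E).
  move=> p0; apply/measurable_EFinP; apply: measurable_kappa => //.
have k0 p x : 0 < p -> (0 <= (kappa (e x) p)%:E)%E.
  by move=> p0; rewrite lee_fin kappa_ge0.
have mEe : measurable_fun setT (EFin \o e) by exact/measurable_EFinP.
have e0' x : (0 <= (e x)%:E)%E by rewrite lee_fin ltW.
have m0' : 0 <= m by rewrite ltW.
have q0' : 0 <= q by rewrite ltW.
have DI (c : R) (h : T -> R) (b : R) : 0 <= c -> 0 <= b ->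
    measurable_fun setT (EFin \o h) -> (forall x, 0 <= (h x)%:E)%E ->
    (\int[Q]_x ((h x)%:E + (c * e x + b)%:E) =
     \int[Q]_x (h x)%:E + (c * m + b)%:E)%E.
  move=> c0 b0 mh h0; rewrite ge0_integralD//; last 2 first.
  - by move=> x _; rewrite lee_fin addr_ge0// mulr_ge0// ltW.
  - apply/measurable_EFinP; apply: measurable_funD => //.
    exact: measurable_funM.
  congr (_ + _)%E; under eq_integral do rewrite EFinD EFinM.
  rewrite ge0_integralD//; last 2 first.
  - by move=> x _; rewrite mule_ge0.
  - exact: measurable_funeM.
  by rewrite ge0_integralZl_EFin// Em integral_probability_cst -EFinM -EFinD.
(* According to the sign of ln (m / q), the term e * ln (m / q) is put on the
   side where it is nonnegative: the divergences may have infinite integrals,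
   so nothing can be subtracted from them. *)
have [L0|L0] := leP 0 (ln (m / q)).
- have := DI (ln (m / q)) _ q L0 q0' (mk _ m0) (k0 _ ^~ m0).
  have -> : (\int[Q]_x ((kappa (e x) m)%:E + (ln (m / q) * e x + q)%:E) =
             \int[Q]_x ((kappa (e x) q)%:E + (0 * e x + m)%:E))%E.
    apply: eq_integral => x _; rewrite -!EFinD; congr (_%:E).
    rewrite (@kappa_three_points _ (e x) m q)//.
    by move: (ln _) => L; ring.
  rewrite (DI 0 _ m (lexx _) m0' (mk _ q0) (k0 _ ^~ q0)).
  have -> : (ln (m / q) * m + q = kappa m q + (0 * m + m))%R.
    by rewrite /kappa; move: (ln _) => L; ring.
  by rewrite (EFinD (kappa m q)) addeA => /adde_fin_inj <-.
- have L0' : 0 <= - ln (m / q) by rewrite oppr_ge0 ltW.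
  have := DI (- ln (m / q)) _ m L0' m0' (mk _ q0) (k0 _ ^~ q0).
  have -> : (\int[Q]_x ((kappa (e x) q)%:E + (- ln (m / q) * e x + m)%:E) =
             \int[Q]_x ((kappa (e x) m)%:E + (0 * e x + q)%:E))%E.
    apply: eq_integral => x _; rewrite -!EFinD; congr (_%:E).
    rewrite (@kappa_three_points _ (e x) m q)//.
    by move: (ln _) => L; ring.
  rewrite (DI 0 _ q (lexx _) q0' (mk _ m0) (k0 _ ^~ m0)).
  have -> : (0 * m + q = kappa m q + (- ln (m / q) * m + m))%R.
    by rewrite /kappa; move: (ln _) => L; ring.
  by rewrite (EFinD (kappa m q)) addeA => /adde_fin_inj <-.
Qed.

End probability_integrals.

(** * One Gaussian observation *)

Section gaussian_divergences.
Context {R : realType} {n : nat}.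
Implicit Types (a b c w x y z : n.-tuple R).
Variable G : probability (n.-tuple R) R.
Hypothesis gaussG : gaussian_measure G.

Lemma measurable_tiltr d (T : measurableType d) (u : T -> n.-tuple R) z :
  measurable_fun setT u -> measurable_fun setT (fun t => tilt (u t) z).
Proof. by move=> mu; apply: measurable_tilt => //; exact: measurable_cst. Qed.

Lemma measurable_tiltl a : measurable_fun setT (tilt a).
Proof. by apply: measurable_tilt => //; exact: measurable_cst. Qed.

(** The divergence between two translates of the Gaussian measure. *)
Lemma integral_kappa_tilt a c :
  (\int[G]_z (kappa (tilt a z) (tilt c z))%:E =
   (dot (vsub a c) (vsub a c) / 2)%:E)%E.
Proof.
pose b := vsub c a; pose K z := kappa 1 (tilt b z).
have K0 z : (0 <= (K z)%:E)%E by rewrite lee_fin kappa_ge0// tilt_gt0.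
have mK : measurable_fun setT (fun z => (K z)%:E).
  apply/measurable_EFinP; apply: measurable_kappa => //.
  - exact: measurable_tiltl.
  - by move=> z; exact: tilt_gt0.
have mNz : measurable_fun setT (fun z : n.-tuple R => vscale (-1) z).
  by apply: measurable_vscale => //; exact: measurable_cst.
transitivity (\int[G]_z (K z)%:E)%E.
  pose F z := kappa 1 (tilt c z / tilt a z).
  have mF : measurable_fun setT (fun z => (F z)%:E).
    apply/measurable_EFinP; apply: measurable_kappa => //.
    - rewrite /tilt; under eq_fun do rewrite -expRN -expRD.
      apply: measurableT_comp => //; apply: measurable_funD.
      + apply: measurable_funB => //; apply: measurable_dot => //; exact: measurable_cst.
      + apply: measurable_funN; apply: measurable_funB => //.
        by apply: measurable_dot => //; exact: measurable_cst.
    - by move=> z; rewrite divr_gt0// tilt_gt0.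
  transitivity (\int[G]_z ((F z)%:E * (tilt a z)%:E))%E.
    apply: eq_integral => z _; rewrite -EFinM; congr (_%:E).
    rewrite mulrC -kappa_scale ?tilt_gt0// mulr1 mulrC divfK//.
    by rewrite gt_eqF// tilt_gt0.
  rewrite ge0_integral_tilt//; last first.
    by move=> z; rewrite lee_fin kappa_ge0// divr_gt0// tilt_gt0.
  apply: eq_integral => z _; rewrite /F /K /tilt -expRN -expRD; congr (kappa 1 (expR _))%:E.
  by rewrite /b !dotE !(dotC c a); field.
(* After translation the integrand is an affine function of <b, z> plus an
   exponential; adding the values at z and - z eliminates the linear part. *)
have E2 : (\int[G]_z (K z)%:E + \int[G]_z (K z)%:E + 2%:E =
           (dot b b)%:E + 2%:E)%E.
  rewrite -{2}(ge0_integral_gaussianN gaussG mK K0) -ge0_integralD//; last exact: (measurableT_comp mK mNz).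
  rewrite -[X in (_ + X)%E](integral_probability_cst G) -ge0_integralD//; last 2 first.
  - by move=> z _; rewrite adde_ge0.
  - by apply: emeasurable_funD => //; exact: (measurableT_comp mK mNz).
  have mt : measurable_fun setT (fun z => (tilt b z)%:E).
    by apply/measurable_EFinP; exact: measurable_tiltl.
  have mtN : measurable_fun setT (fun z => (tilt b (vscale (-1) z))%:E).
    exact: (measurableT_comp mt mNz).
  transitivity (\int[G]_z ((dot b b)%:E + ((tilt b z)%:E + (tilt b (vscale (-1) z))%:E)))%E.
    apply: eq_integral => z _; rewrite /K /kappa -!EFinD; congr (_%:E).
    rewrite !mul1r !lnV ?posrE ?tilt_gt0// /tilt !expRK !dotE.
    by field.
  rewrite ge0_integralD//; last 3 first.
  - by move=> z _; rewrite lee_fin dot_ge0.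
  - by move=> z _; rewrite adde_ge0// lee_fin tilt_ge0.
  - exact: emeasurable_funD.
  rewrite ge0_integralD//; last 2 first.
  - by move=> z _; rewrite lee_fin tilt_ge0.
  - by move=> z _; rewrite lee_fin tilt_ge0.
  rewrite (ge0_integral_gaussianN gaussG mt); last by move=> z; rewrite lee_fin tilt_ge0.
  by rewrite integral_tilt// integral_probability_cst.
move: E2 => /adde_fin_inj.
have -> : dot (vsub a c) (vsub a c) = dot b b.
  by rewrite /b !dotE !(dotC c a); ring.
have : (0 <= \int[G]_z (K z)%:E)%E by apply: integral_ge0 => z _; exact: K0.
case: (\int[G]_z (K z)%:E)%E => //= r _ [rr].
by congr (_%:E); rewrite -rr; field.
Qed.

(** The integral that governs chi-square divergences from a translated Gaussian
    measure. *)
Lemma integral_tilt_overlap a b c :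
  (\int[G]_z (tilt a z * tilt b z / tilt c z)%:E =
   (expR (dot (vsub a c) (vsub b c)))%:E)%E.
Proof.
transitivity (\int[G]_z ((expR (dot (vsub a c) (vsub b c)))%:E *
                         (tilt (vsub (vadd a b) c) z)%:E))%E.
  apply: eq_integral => z _; rewrite -EFinM; congr (_%:E).
  rewrite /tilt -expRN -!expRD; congr (expR _); rewrite !dotE.
  by rewrite !(dotC c b) !(dotC b a) !(dotC c a); field.
rewrite ge0_integralZl_EFin ?expR_ge0//.
- by rewrite integral_tilt// mule1.
- by move=> z _; rewrite lee_fin tilt_ge0.
- by apply/measurable_EFinP; exact: measurable_tiltl.
Qed.

(** A bound uniform in the translation, which makes all mixtures finite. *)
Lemma tilt_le a z : tilt a z <= expR (dot z z / 2).
Proof.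
rewrite /tilt ler_expR; have := dot_ge0 (vsub a z).
by rewrite !dotE !(dotC z a); lra.
Qed.

End gaussian_divergences.

Section mixture.
Context {R : realType} {n : nat} d (T : measurableType d).
Variables (Q : probability T R) (G : probability (n.-tuple R) R).
Hypothesis gaussG : gaussian_measure G.
Implicit Types (u v : T -> n.-tuple R) (z : n.-tuple R).

(** The density, with respect to the standard Gaussian measure, of the law of
    [u + Z] where [Z] is a standard Gaussian vector independent of [u]. *)
Definition mixture u z : R := \int[Q]_w tilt (u w) z.

(** The mutual information between [u] and [u + Z]. *)
Definition gaussian_information u : \bar R :=
  (\int[Q]_w \int[G]_z (kappa (tilt (u w) z) (mixture u z))%:E)%E.

Lemma bounded_tilt u z : measurable_fun setT u ->
  bounded_mfun (fun w => tilt (u w) z).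
Proof.
move=> mu; split; first exact: measurable_tiltr.
by exists (expR (dot z z / 2)) => w; rewrite ger0_norm ?tilt_ge0// tilt_le.
Qed.

Lemma mixtureE u z : measurable_fun setT u ->
  ((mixture u z)%:E = \int[Q]_w (tilt (u w) z)%:E)%E.
Proof. by move=> mu; rewrite -EFin_bounded_Rintegral//; exact: bounded_tilt. Qed.

Lemma mixture_gt0 u z : measurable_fun setT u -> 0 < mixture u z.
Proof.
move=> mu; apply: Rintegral_gt0.
- exact: measurable_tiltr.
- by move=> w; exact: tilt_gt0.
- by rewrite -mixtureE// ltry.
Qed.

Lemma measurable_tilt_pair u : measurable_fun setT u ->
  measurable_fun setT (fun p : n.-tuple R * T => tilt (u p.2) p.1).
Proof. by move=> mu; apply: measurable_tilt => //; exact: measurableT_comp. Qed.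

Lemma measurable_mixture u : measurable_fun setT u -> measurable_fun setT (mixture u).
Proof.
move=> mu; apply/measurable_EFinP.
rewrite (_ : _ \o _ = fun z => \int[Q]_w (tilt (u w) z)%:E)%E.
  apply: (@measurable_fun_fubini_tonelli_F _ _ _ _ R Q
    (fun p => (tilt (u p.2) p.1)%:E)).
  - by apply/measurable_EFinP; exact: measurable_tilt_pair.
  - by move=> p; rewrite lee_fin tilt_ge0.
by apply/funext => z /=; rewrite mixtureE.
Qed.

Lemma integral_mixture u : measurable_fun setT u ->
  (\int[G]_z (mixture u z)%:E = 1)%E.
Proof.
move=> mu; under eq_integral do rewrite mixtureE//.
rewrite (@fubini_tonelli _ _ _ _ R G Q (fun p => (tilt (u p.2) p.1)%:E))/=.
- under eq_integral do rewrite integral_tilt//.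
  exact: integral_probability_cst.
- by apply/measurable_EFinP; exact: measurable_tilt_pair.
- by move=> p; rewrite lee_fin tilt_ge0.
Qed.

Lemma measurable_kappa_mixture u : measurable_fun setT u ->
  measurable_fun setT (fun p : n.-tuple R * T =>
    (kappa (tilt (u p.2) p.1) (mixture u p.1))%:E).
Proof.
move=> mu; apply/measurable_EFinP; apply: measurable_kappa.
- exact: measurable_tilt_pair.
- by apply: (measurableT_comp (measurable_mixture mu)).
- by move=> p; exact: mixture_gt0.
Qed.

Lemma gaussian_informationE u : measurable_fun setT u ->
  (gaussian_information u =
   \int[G]_z \int[Q]_w (kappa (tilt (u w) z) (mixture u z))%:E)%E.
Proof.
move=> mu; rewrite (@fubini_tonelli _ _ _ _ R G Q
  (fun p => (kappa (tilt (u p.2) p.1) (mixture u p.1))%:E))//.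
- exact: measurable_kappa_mixture.
- by move=> p; rewrite lee_fin kappa_ge0 ?tilt_gt0 ?mixture_gt0.
Qed.

End mixture.

Lemma lee_cancel_chi2 (R : realType) (c : R) (k h : \bar R) :
  (0 <= h -> 0 <= k -> h <= (1 + c)%:E -> k + 2%:E <= h + 1%:E -> k <= c%:E)%E.
Proof.
case: h => [h| |] // _; case: k => [k| |] // _; rewrite -?EFinD ?lee_fin.
by move=> h1 h2; lra.
Qed.

Lemma lee_of_variance_bounds (R : realType) (a b : R) (c iu iv ku kv : \bar R) :
  (iu + ku = (a / 2)%:E -> iv + kv = (b / 2)%:E -> ku <= c -> 0 <= kv ->
   (b <= a)%R -> iv <= iu + c)%E.
Proof.
move=> Iu Iv kuc kv0 ba; apply: (@le_trans _ _ (iv + kv)%E); first exact: leeDl.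
rewrite Iv; apply: (@le_trans _ _ (iu + ku)%E); last exact: leeD2l.
by rewrite Iu lee_fin ler_pM2r.
Qed.

Section one_observation.
Context {R : realType} {n : nat} d (T : measurableType d).
Variables (Q : probability T R) (G : probability (n.-tuple R) R).
Hypothesis gaussG : gaussian_measure G.
Implicit Types (u v : T -> n.-tuple R) (x z : n.-tuple R).

(** The coordinatewise mean of [u] under [Q]. *)
Definition vmean u : n.-tuple R := [tuple \int[Q]_w tnth (u w) i | i < n].

Lemma dot_le_half x z : `|dot x z| <= (dot x x + dot z z) / 2.
Proof.
rewrite ler_norml; apply/andP; split.
- have := dot_ge0 (vadd x z); rewrite !dotE !(dotC z x); lra.
- have := dot_ge0 (vsub x z); rewrite !dotE !(dotC z x); lra.
Qed.

Section bounded.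
Variables (u : T -> n.-tuple R) (B : R).
Hypothesis mu : measurable_fun setT u.
Hypothesis uB : forall w, dot (u w) (u w) <= B.
Let c := vmean u.

Let bt i : bounded_mfun (fun w => tnth (u w) i).
Proof.
split; first exact: measurable_tnth_comp.
exists (Num.sqrt B) => w; rewrite -sqrtr_sqr ler_wsqrtr// (le_trans _ (uB w))//.
rewrite /dot (bigD1 i)//= -expr2 lerDl.
by apply: sumr_ge0 => j _; rewrite -expr2 sqr_ge0.
Qed.

Let bdotl x : bounded_mfun (fun w => dot (u w) x).
Proof.
apply: bounded_mfun_sum => i; apply: bounded_mfunM => //; exact: bounded_mfun_cst.
Qed.

Let bdot : bounded_mfun (fun w => dot (u w) (u w)).
Proof. by apply: bounded_mfun_sum => i; exact: bounded_mfunM. Qed.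

Lemma Rintegral_dot x : \int[Q]_w dot (u w) x = dot c x.
Proof.
rewrite bounded_Rintegral_sum; last first.
  by move=> i; apply: bounded_mfunM => //; exact: bounded_mfun_cst.
apply: eq_bigr => i _; rewrite tnth_mktuple -(mulrC (tnth x i)).
rewrite -bounded_RintegralZl//; apply: eq_Rintegral => w _; exact: mulrC.
Qed.

Lemma bounded_dot_vsub x : bounded_mfun (fun w => dot (vsub (u w) x) (vsub (u w) x)).
Proof.
under eq_fun do rewrite !dotE.
by apply: bounded_mfunB; apply: bounded_mfunB => //;
  [under eq_fun do rewrite dotC|exact: bounded_mfun_cst].
Qed.

Lemma Rintegral_dot_vsub x :
  \int[Q]_w dot (vsub (u w) x) (vsub (u w) x) =
  \int[Q]_w dot (u w) (u w) - 2 * dot c x + dot x x.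
Proof.
transitivity (\int[Q]_w (dot (u w) (u w) + ((-2) * dot (u w) x + dot x x))).
  by apply: eq_Rintegral => w _; rewrite !dotE (dotC x); ring.
rewrite bounded_RintegralD//; last first.
  apply: bounded_mfunD; last exact: bounded_mfun_cst.
  by apply: bounded_mfunM => //; exact: bounded_mfun_cst.
rewrite bounded_RintegralD//; last 2 first.
- by apply: bounded_mfunM => //; exact: bounded_mfun_cst.
- exact: bounded_mfun_cst.
by rewrite bounded_RintegralZl// Rintegral_dot bounded_Rintegral_cst; ring.
Qed.

(** The variance as a double integral of squared distances. *)
Lemma Rintegral_variance_pairs :
  \int[Q]_w' \int[Q]_w dot (vsub (u w) (u w')) (vsub (u w) (u w')) =
  2 * \int[Q]_w dot (vsub (u w) c) (vsub (u w) c).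
Proof.
under eq_Rintegral do rewrite Rintegral_dot_vsub.
rewrite Rintegral_dot_vsub; set S := \int[Q]_w dot (u w) (u w).
transitivity (\int[Q]_w (dot (u w) (u w) + ((-2) * dot (u w) c + S))).
  by apply: eq_Rintegral => w _; rewrite (dotC c); ring.
rewrite bounded_RintegralD//; last first.
  apply: bounded_mfunD; last exact: bounded_mfun_cst.
  by apply: bounded_mfunM => //; exact: bounded_mfun_cst.
rewrite bounded_RintegralD//; last 2 first.
- by apply: bounded_mfunM => //; exact: bounded_mfun_cst.
- exact: bounded_mfun_cst.
rewrite bounded_RintegralZl// Rintegral_dot bounded_Rintegral_cst -/S; ring.
Qed.

Lemma bounded_variance_pairs : bounded_mfun (fun w' =>
  \int[Q]_w dot (vsub (u w) (u w')) (vsub (u w) (u w'))).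
Proof.
under eq_fun do rewrite Rintegral_dot_vsub.
apply: bounded_mfunD => //; apply: bounded_mfunB; first exact: bounded_mfun_cst.
apply: bounded_mfunM; first exact: bounded_mfun_cst.
by under eq_fun do rewrite dotC.
Qed.

Lemma dot_vmean_le : dot c c <= B.
Proof.
have : 0 <= \int[Q]_w dot (vsub (u w) c) (vsub (u w) c).
  by apply: Rintegral_ge0 => w _; exact: dot_ge0.
have : \int[Q]_w dot (u w) (u w) <= B.
  rewrite -[leRHS](bounded_Rintegral_cst Q).
  by apply: le_bounded_Rintegral => //; exact: bounded_mfun_cst.
rewrite Rintegral_dot_vsub; lra.
Qed.

(** The factor [4] is [(1 + 1) ^ 2]: both [u] and its mean have squared norm at
    most [B]. *)
Lemma dot_centered_le w w' : `|dot (vsub (u w) c) (vsub (u w') c)| <= 4 * B.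
Proof.
have h y : dot (vsub (u y) c) (vsub (u y) c) <= 4 * B.
  have := dot_ge0 (vadd (u y) c); have := uB y; have := dot_vmean_le.
  rewrite !dotE !(dotC c); lra.
by apply: (le_trans (dot_le_half _ _)); have := h w; have := h w'; lra.
Qed.

Let q z := tilt c z.

Let mix0 z : 0 < mixture Q u z. Proof. exact: mixture_gt0. Qed.

Let q0 z : 0 < q z. Proof. exact: tilt_gt0. Qed.

Let mmix : measurable_fun setT (fun z => (mixture Q u z)%:E).
Proof. by apply/measurable_EFinP; exact: measurable_mixture. Qed.

Let mq : measurable_fun setT (fun z => (q z)%:E).
Proof. by apply/measurable_EFinP; exact: measurable_tiltl. Qed.

Let miq : measurable_fun setT (fun z => (q z)^-1).
Proof.
rewrite (_ : (fun _ => _) = fun z => expR (- (dot c z - dot c c / 2))).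
  apply: measurableT_comp => //; apply: measurable_funN.
  by apply: measurable_funB => //; apply: measurable_dot => //; exact: measurable_cst.
by apply/funext => z; rewrite expRN.
Qed.

(** The law of [u + Z] is compared with the Gaussian law with the same mean;
    their chi-square divergence is the integral over pairs of
    [exp <u - c, u' - c> - 1], whose linear part vanishes. *)
Lemma integral_mixture_chi2_le : 4 * B <= 1 ->
  (\int[G]_z (mixture Q u z ^+ 2 / q z)%:E <= (1 + 2 * (4 * B) ^+ 2)%:E)%E.
Proof.
move=> B1.
have tt0 w z w' : (0 <= (tilt (u w) z * tilt (u w') z / q z)%:E)%E.
  by rewrite lee_fin divr_ge0// ?mulr_ge0 ?tilt_ge0// ltW.
have -> : (\int[G]_z (mixture Q u z ^+ 2 / q z)%:E =
    \int[G]_z \int[Q]_w' \int[Q]_w (tilt (u w) z * tilt (u w') z / q z)%:E)%E.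
  apply: eq_integral => z _.
  have tz0 w : (0 <= (tilt (u w) z)%:E)%E by rewrite lee_fin tilt_ge0.
  have mtz : measurable_fun setT (fun w => (tilt (u w) z)%:E).
    by apply/measurable_EFinP; exact: measurable_tiltr.
  transitivity (\int[Q]_w' ((mixture Q u z / q z)%:E * (tilt (u w') z)%:E))%E.
    rewrite ge0_integralZl_EFin//; last by rewrite divr_ge0// ltW.
    by rewrite -mixtureE// -EFinM; congr (_%:E); rewrite expr2 mulrAC.
  apply: eq_integral => w' _.
  transitivity (\int[Q]_w ((tilt (u w') z / q z)%:E * (tilt (u w) z)%:E))%E.
    rewrite ge0_integralZl_EFin//; last by rewrite divr_ge0 ?tilt_ge0// ltW.
    by rewrite -mixtureE// -!EFinM; congr (_%:E); ring.
  by apply: eq_integral => w _; rewrite -EFinM; congr (_%:E); ring.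
(* The integration over the noise is performed first: it is explicit. *)
have mtt2 z : measurable_fun setT (fun p : T * T =>
    (tilt (u p.2) z * tilt (u p.1) z / q z)%:E).
  apply/measurable_EFinP; apply: measurable_funM => //.
  apply: measurable_funM; apply: measurable_tiltr.
  - exact: (measurableT_comp mu measurable_snd).
  - exact: (measurableT_comp mu measurable_fst).
have -> : (\int[G]_z \int[Q]_w' \int[Q]_w (tilt (u w) z * tilt (u w') z / q z)%:E =
    \int[Q]_w' \int[Q]_w \int[G]_z (tilt (u w) z * tilt (u w') z / q z)%:E)%E.
  pose Qp : probability _ R := (Q \x Q)%E.
  transitivity (\int[G]_z \int[(Q \x Q)%E]_p
      (tilt (u p.2) z * tilt (u p.1) z / q z)%:E)%E.
    apply: eq_integral => z _.
    by rewrite (@fubini_tonelli1 _ _ _ _ R Q Q (fun p =>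
      (tilt (u p.2) z * tilt (u p.1) z / q z)%:E)).
  have mbig : measurable_fun setT (fun r : n.-tuple R * (T * T) =>
      (tilt (u r.2.2) r.1 * tilt (u r.2.1) r.1 / q r.1)%:E).
    apply/measurable_EFinP; apply: measurable_funM.
      apply: measurable_funM; apply: measurable_tilt => //.
      - exact: (measurableT_comp mu (measurableT_comp measurable_snd measurable_snd)).
      - exact: (measurableT_comp mu (measurableT_comp measurable_fst measurable_snd)).
    exact: (measurableT_comp miq measurable_fst).
  rewrite (@fubini_tonelli _ _ _ _ R G Qp (fun r =>
    (tilt (u r.2.2) r.1 * tilt (u r.2.1) r.1 / q r.1)%:E))//.
  rewrite (@fubini_tonelli1 _ _ _ _ R Q Q (fun p =>
     \int[G]_z (tilt (u p.2) z * tilt (u p.1) z / q z)%:E)%E)//.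
  - exact: (@measurable_fun_fubini_tonelli_G _ _ _ _ R G (fun r =>
      (tilt (u r.2.2) r.1 * tilt (u r.2.1) r.1 / q r.1)%:E)).
  - by move=> p; apply: integral_ge0.
have bdc w' : bounded_mfun (fun w => dot (vsub (u w) c) (vsub (u w') c)).
  under eq_fun do rewrite dotBl.
  by apply: bounded_mfunB => //; exact: bounded_mfun_cst.
rewrite -[leRHS](integral_probability_cst Q); apply: ge0_le_integral => //.
- by move=> w' _; apply: integral_ge0 => w _; exact: integral_ge0.
- have mE : measurable_fun setT (fun p : T * T =>
      (expR (dot (vsub (u p.2) c) (vsub (u p.1) c)))%:E).
    apply/measurable_EFinP; apply: measurableT_comp => //.
    have mv (g : T * T -> T) : measurable_fun setT g ->
        measurable_fun setT (fun p => vsub (u (g p)) c).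
      move=> mg; apply/measurable_fun_tnthP => i.
      rewrite (_ : _ \o _ = fun p => tnth (u (g p)) i - tnth c i).
        by apply: measurable_funB => //; apply: measurable_tnth_comp; exact: measurableT_comp.
      by apply/funext => p /=; rewrite tnth_mktuple.
    by apply: measurable_dot; exact: mv.
  under eq_fun do under eq_integral do rewrite integral_tilt_overlap//.
  apply: (@measurable_fun_fubini_tonelli_F _ _ _ _ R Q _ mE) => p.
  by rewrite lee_fin expR_ge0.
- move=> w' _; under eq_integral do rewrite integral_tilt_overlap//.
  apply: (@le_trans _ _ (\int[Q]_w ((1 + 2 * (4 * B) ^+ 2) +
    dot (vsub (u w) c) (vsub (u w') c))%:E)%E).
    have [_ [M dM]] := bdc w'.
    apply: ge0_le_integral => //.
    + apply/measurable_EFinP; apply: measurableT_comp => //; exact: (bdc w').1.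
    + by apply/measurable_EFinP; apply: measurable_funD => //; exact: (bdc w').1.
    + move=> w _; rewrite lee_fin.
      have := dot_centered_le w w'; rewrite ler_norml => /andP[h1 h2].
      apply: (le_trans (expR_le_quadratic _)); first exact: le_trans B1.
      move: (dot _ _) h1 h2 => x h1 h2.
      have : 0 <= (4 * B - x) * (4 * B + x) by rewrite mulr_ge0; lra.
      lra.
  rewrite -EFin_bounded_Rintegral; last first.
    by apply: bounded_mfunD => //; exact: bounded_mfun_cst.
  rewrite lee_fin bounded_RintegralD//; last exact: bounded_mfun_cst.
  rewrite bounded_Rintegral_cst (_ : \int[Q]_w dot _ _ = 0) ?addr0//.
  under eq_Rintegral do rewrite dotBl.
  rewrite bounded_RintegralB//; last exact: bounded_mfun_cst.
  by rewrite Rintegral_dot bounded_Rintegral_cst subrr.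
Qed.

(** The information is half the variance of [u], minus the divergence of the
    law of [u + Z] from the Gaussian law with the same mean. *)
Lemma gaussian_information_variance :
  (gaussian_information Q G u + \int[G]_z (kappa (mixture Q u z) (q z))%:E =
   ((\int[Q]_w dot (vsub (u w) c) (vsub (u w) c)) / 2)%:E)%E.
Proof.
have mk2 : measurable_fun setT (fun p : n.-tuple R * T =>
    (kappa (tilt (u p.2) p.1) (q p.1))%:E).
  apply/measurable_EFinP; apply: measurable_kappa => //.
  - exact: measurable_tilt_pair.
  - by apply: (measurableT_comp (measurable_tiltl c)).
rewrite gaussian_informationE// -ge0_integralD//; last 4 first.
- move=> z _; apply: integral_ge0 => w _.
  by rewrite lee_fin kappa_ge0 ?tilt_gt0.
- apply: (@measurable_fun_fubini_tonelli_F _ _ _ _ R Q _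
    (measurable_kappa_mixture Q mu)) => p.
  by rewrite lee_fin kappa_ge0 ?tilt_gt0.
- by move=> z _; rewrite lee_fin kappa_ge0.
- apply/measurable_EFinP; apply: measurable_kappa => //.
    exact: measurable_mixture.
  exact: measurable_tiltl.
transitivity (\int[G]_z \int[Q]_w (kappa (tilt (u w) z) (q z))%:E)%E.
  apply: eq_integral => z _; apply: integral_kappa_compensation => //.
  - exact: measurable_tiltr.
  - by move=> w; exact: tilt_gt0.
  - by rewrite mixtureE.
rewrite (@fubini_tonelli _ _ _ _ R G Q _ mk2)/=; last first.
  by move=> p; rewrite lee_fin kappa_ge0 ?tilt_gt0.
under eq_integral do rewrite integral_kappa_tilt//.
rewrite -EFin_bounded_Rintegral; last first.
  by apply: bounded_mfunM; [exact: bounded_dot_vsub|exact: bounded_mfun_cst].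
congr (_%:E); under eq_Rintegral do rewrite mulrC.
by rewrite bounded_RintegralZl 1?mulrC//; exact: bounded_dot_vsub.
Qed.

Lemma integral_kappa_mixture_le : 4 * B <= 1 ->
  (\int[G]_z (kappa (mixture Q u z) (q z))%:E <= (2 * (4 * B) ^+ 2)%:E)%E.
Proof.
move=> B1.
have mk : measurable_fun setT (fun z => (kappa (mixture Q u z) (q z))%:E).
  apply/measurable_EFinP; apply: measurable_kappa => //.
    exact: measurable_mixture.
  exact: measurable_tiltl.
have k0 z : (0 <= (kappa (mixture Q u z) (q z))%:E)%E by rewrite lee_fin kappa_ge0.
have m20 z : (0 <= 2%:E * (mixture Q u z)%:E)%E.
  by rewrite -EFinM lee_fin mulr_ge0// ltW.
have c20 z : (0 <= (mixture Q u z ^+ 2 / q z)%:E)%E.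
  by rewrite lee_fin divr_ge0 ?sqr_ge0// ltW.
have mc2 : measurable_fun setT (fun z => (mixture Q u z ^+ 2 / q z)%:E).
  apply/measurable_EFinP; apply: measurable_funM => //; apply: measurable_funX.
  exact: measurable_mixture.
have m2m : measurable_fun setT (fun z => (2%:E * (mixture Q u z)%:E)%E).
  exact: measurable_funeM.
have : (\int[G]_z ((kappa (mixture Q u z) (q z))%:E + 2%:E * (mixture Q u z)%:E) <=
        \int[G]_z ((mixture Q u z ^+ 2 / q z)%:E + (q z)%:E))%E.
  apply: ge0_le_integral => //.
  - by move=> z _; rewrite adde_ge0.
  - exact: emeasurable_funD.
  - exact: emeasurable_funD.
  - by move=> z _; rewrite -EFinM -!EFinD lee_fin kappa_le_chi2.
have q0' z : (0 <= (q z)%:E)%E by rewrite lee_fin ltW.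
have mix0' z : (0 <= (mixture Q u z)%:E)%E by rewrite lee_fin ltW.
rewrite !ge0_integralD// ge0_integralZl_EFin//.
rewrite integral_mixture// mule1 (integral_tilt gaussG).
have := integral_mixture_chi2_le B1.
have : (0 <= \int[G]_z (kappa (mixture Q u z) (q z))%:E)%E by exact: integral_ge0.
have : (0 <= \int[G]_z (mixture Q u z ^+ 2 / q z)%:E)%E by exact: integral_ge0.
exact: lee_cancel_chi2.
Qed.

End bounded.

(** To second order in the size of the signal, the information carried by one
    Gaussian observation of [u] is half the variance of [u]; hence contracting
    [u] into [v] can increase it only by an error quadratic in [B]. *)
Lemma gaussian_information_small_contraction u v (B : R) :
  measurable_fun setT u -> measurable_fun setT v ->
  (forall w, dot (u w) (u w) <= B) -> (forall w, dot (v w) (v w) <= B) ->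
  4 * B <= 1 ->
  (forall w w', dot (vsub (v w) (v w')) (vsub (v w) (v w')) <=
                dot (vsub (u w) (u w')) (vsub (u w) (u w'))) ->
  (gaussian_information Q G v <=
   gaussian_information Q G u + (2 * (4 * B) ^+ 2)%:E)%E.
Proof.
move=> mu mv uB vB B1 vu.
have := gaussian_information_variance mv vB.
have := gaussian_information_variance mu uB.
have := integral_kappa_mixture_le mu uB B1.
have : \int[Q]_w dot (vsub (v w) (vmean v)) (vsub (v w) (vmean v)) <=
       \int[Q]_w dot (vsub (u w) (vmean u)) (vsub (u w) (vmean u)).
  have : \int[Q]_w' \int[Q]_w dot (vsub (v w) (v w')) (vsub (v w) (v w')) <=
         \int[Q]_w' \int[Q]_w dot (vsub (u w) (u w')) (vsub (u w) (u w')).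
    apply: le_bounded_Rintegral => [||w'].
    - exact: bounded_variance_pairs vB.
    - exact: bounded_variance_pairs uB.
    apply: le_bounded_Rintegral => [||w].
    - exact: bounded_dot_vsub vB _.
    - exact: bounded_dot_vsub uB _.
    exact: vu.
  by rewrite (Rintegral_variance_pairs mu uB) (Rintegral_variance_pairs mv vB) ler_pM2l.
have : (0 <= \int[G]_z (kappa (mixture Q v z) (tilt (vmean v) z))%:E)%E.
  by apply: integral_ge0 => z _; rewrite lee_fin kappa_ge0 ?tilt_gt0 ?mixture_gt0.
move=> Kv0 Vvu Ku Iu Iv.
exact: lee_of_variance_bounds Iu Iv Ku Kv0 Vvu.
Qed.

End one_observation.

(** * The chain rule for one additional Gaussian observation *)

Section information.
Context {R : realType} {d d'} {T : measurableType d} {Y : measurableType d'}.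

(** The density of the observation under the law [P] of the parameter, when [k]
    is the density of the observation given the parameter. *)
Definition marginal (P : probability T R) (k : T -> Y -> R) (y : Y) : R :=
  \int[P]_w k w y.

(** The mutual information between the parameter and the observation. *)
Definition information (P : probability T R) (nu : probability Y R)
    (k : T -> Y -> R) : \bar R :=
  (\int[P]_w \int[nu]_y (kappa (k w y) (marginal P k y))%:E)%E.

Lemma measurable_marginal (P : probability T R) (k : T -> Y -> R) :
  measurable_fun setT (fun p : T * Y => k p.1 p.2) -> (forall w y, 0 <= k w y) ->
  measurable_fun setT (marginal P k).
Proof.
move=> mk k0; apply: (@measurableT_comp _ _ _ _ _ _ fine).
  exact: fine_measurable.
apply: (@measurable_fun_fubini_tonelli_G _ _ _ _ R P
  (fun p => (k p.1 p.2)%:E)); first exact/measurable_EFinP.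
by move=> p; rewrite lee_fin.
Qed.

(** A family of probability densities which is measurable in all variables and
    has finite mixtures. *)
Record statistical_model (P : probability T R) (nu : probability Y R)
    (k : T -> Y -> R) : Prop := StatisticalModel {
  model_measurable : measurable_fun setT (fun p : T * Y => k p.1 p.2) ;
  model_gt0 : forall w y, 0 < k w y ;
  model_density : forall w, (\int[nu]_y (k w y)%:E = 1)%E ;
  model_marginal : forall y, (\int[P]_w (k w y)%:E < +oo)%E }.

End information.

(** The density of a pair of observations, the second being that of [u] with
    independent standard Gaussian noise. *)
Definition observe {R : realType} {n} {T Y : Type} (k : T -> Y -> R)
    (u : T -> n.-tuple R) (w : T) (p : Y * n.-tuple R) : R :=
  k w p.1 * tilt (u w) p.2.

Section chain_rule.
Context {R : realType} {n : nat} {d d'} {T : measurableType d}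
  {Y : measurableType d'}.
Variables (P : probability T R) (nu : probability Y R).
Variable G : probability (n.-tuple R) R.
Hypothesis gaussG : gaussian_measure G.
Variable k : T -> Y -> R.
Hypothesis modelk : statistical_model P nu k.
Implicit Types (u v : T -> n.-tuple R) (y : Y) (z : n.-tuple R).

Let mk : measurable_fun setT (fun p : T * Y => k p.1 p.2).
Proof. exact: model_measurable modelk. Qed.

Let k_gt0 w y : 0 < k w y.
Proof. exact: model_gt0 modelk w y. Qed.

Let k_ge0 w y : 0 <= k w y.
Proof. exact: ltW. Qed.

Let mk1 y : measurable_fun setT (fun w => k w y).
Proof. exact: (measurable_fun_pair1 y mk). Qed.

Let mk2 w : measurable_fun setT (fun y => k w y).
Proof. exact: (measurable_fun_pair2 w mk). Qed.

Let g := marginal P k.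

Let gE y : ((g y)%:E = \int[P]_w (k w y)%:E)%E.
Proof. by rewrite -EFin_Rintegral//; exact: model_marginal modelk y. Qed.

Let g_gt0 y : 0 < g y.
Proof. by apply: Rintegral_gt0 => //; exact: model_marginal modelk y. Qed.

Let mg : measurable_fun setT g.
Proof. exact: measurable_marginal. Qed.

Let integral_g : (\int[nu]_y (g y)%:E = 1)%E.
Proof.
under eq_integral do rewrite gE.
rewrite -(@fubini_tonelli _ _ _ _ R P nu (fun p => (k p.1 p.2)%:E))//=.
- under eq_integral do rewrite (model_density modelk).
  exact: integral_probability_cst.
- exact/measurable_EFinP.
- by move=> p; rewrite lee_fin.
Qed.

(** [post y] is the posterior law of the parameter given the observation [y],
    that is, it has the density [k ^~ y / g y] with respect to [P]. *)
Definition posterior (post : Y -> probability T R) := forall y (F : T -> \bar R),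
  measurable_fun setT F -> (forall w, 0 <= F w)%E ->
  (\int[post y]_w F w = \int[P]_w (F w * (k w y / g y)%:E))%E.

Lemma posterior_exists : exists post, posterior post.
Proof.
suff /choice[post postP] : forall y, exists Q : probability T R,
    forall F : T -> \bar R, measurable_fun setT F -> (forall w, 0 <= F w)%E ->
    (\int[Q]_w F w = \int[P]_w (F w * (k w y / g y)%:E))%E by exists post.
move=> y; apply: probability_density.
- exact: measurable_funM.
- by move=> w; rewrite divr_ge0// ltW.
under eq_integral do rewrite mulrC EFinM.
rewrite ge0_integralZl_EFin ?invr_ge0//; last 3 first.
- by move=> w _; rewrite lee_fin.
- exact/measurable_EFinP.
- exact: ltW.
by rewrite -gE -EFinM mulVf// gt_eqF.
Qed.

Variable post : Y -> probability T R.
Hypothesis postP : posterior post.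

Section observation.
Variable u : T -> n.-tuple R.
Hypothesis mu : measurable_fun setT u.

Lemma observe_gt0 w p : 0 < observe k u w p.
Proof. by rewrite mulr_gt0 ?tilt_gt0. Qed.

Lemma measurable_observe :
  measurable_fun setT (fun q : T * (Y * n.-tuple R) => observe k u q.1 q.2).
Proof.
apply: measurable_funM.
  apply: (measurableT_comp (f := fun p : T * Y => k p.1 p.2) mk
    (g := fun q : T * (Y * n.-tuple R) => (q.1, q.2.1))).
  apply/measurable_fun_pairP; split; first exact: measurable_fst.
  exact: (measurableT_comp measurable_fst measurable_snd).
apply: measurable_tilt; first exact: (measurableT_comp mu measurable_fst).
exact: (measurableT_comp measurable_snd measurable_snd).
Qed.

Lemma integral_observe w : (\int[(nu \x G)%E]_p (observe k u w p)%:E = 1)%E.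
Proof.
rewrite fubini_tonelli1//; last 2 first.
- by apply/measurable_EFinP; exact: (measurable_fun_pair2 w measurable_observe).
- by move=> p; rewrite lee_fin ltW ?observe_gt0//.
rewrite -[RHS](model_density modelk w); apply: eq_integral => y _.
rewrite /fubini_F /observe/=; under eq_integral do rewrite EFinM.
rewrite ge0_integralZl_EFin//.
- by rewrite integral_tilt// mule1.
- by move=> z _; rewrite lee_fin tilt_ge0.
- by apply/measurable_EFinP; exact: measurable_tiltl.
Qed.

Let integral_observe_P y z :
  (\int[P]_w (observe k u w (y, z))%:E = (g y * mixture (post y) u z)%:E)%E.
Proof.
have gN0 : g y != 0 by rewrite gt_eqF.
rewrite EFinM mixtureE// postP//; last 2 first.
- by apply/measurable_EFinP; exact: measurable_tiltr.
- by move=> w; rewrite lee_fin tilt_ge0.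
rewrite -ge0_integralZl_EFin ?(ltW (g_gt0 y))//; last 2 first.
- by move=> w _; rewrite -EFinM lee_fin mulr_ge0 ?tilt_ge0 ?divr_ge0// ltW.
- apply: emeasurable_funM; apply/measurable_EFinP; first exact: measurable_tiltr.
  exact: measurable_funM.
apply: eq_integral => w _; rewrite -!EFinM /observe/=; congr (_%:E).
by field.
Qed.

Lemma marginal_observe y z :
  marginal P (observe k u) (y, z) = g y * mixture (post y) u z.
Proof. by rewrite /marginal /Rintegral integral_observe_P. Qed.

Lemma statistical_model_observe :
  statistical_model P (nu \x G)%E (observe k u).
Proof.
split.
- exact: measurable_observe.
- exact: observe_gt0.
- exact: integral_observe.
- by move=> [y z]; rewrite integral_observe_P ltry.
Qed.

Let mmix : measurable_fun setT
  (fun p : Y * n.-tuple R => mixture (post p.1) u p.2).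
Proof.
rewrite (_ : (fun _ => _) = fun p => marginal P (observe k u) p / g p.1).
  apply: measurable_funM.
    apply: measurable_marginal; first exact: measurable_observe.
    by move=> w p; rewrite ltW ?observe_gt0//.
  rewrite (_ : (fun _ => _) = fun p : Y * n.-tuple R => g p.1 `^ (-1)).
    apply: (measurableT_comp (measurable_powR (-1))).
    exact: measurableT_comp.
  by apply/funext => p; rewrite powR_inv1// ltW.
apply/funext => -[y z]; rewrite marginal_observe/= mulrAC divff ?mul1r//.
by rewrite gt_eqF.
Qed.

Let mix_gt0 y z : 0 < mixture (post y) u z.
Proof. exact: mixture_gt0. Qed.

Let H w y : \bar R :=
  (\int[G]_z (kappa (tilt (u w) z) (mixture (post y) u z))%:E)%E.

Let H0 w y : (0 <= H w y)%E.
Proof. by apply: integral_ge0 => z _; rewrite lee_fin kappa_ge0 ?tilt_gt0. Qed.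

Let mH : measurable_fun setT (fun p : T * Y => H p.1 p.2).
Proof.
apply: (@measurable_fun_fubini_tonelli_F _ _ _ _ R G (fun q : (T * Y) * n.-tuple R =>
  (kappa (tilt (u q.1.1) q.2) (mixture (post q.1.2) u q.2))%:E)).
- apply/measurable_EFinP; apply: measurable_kappa => //.
  + apply: measurable_tilt => //.
    exact: (measurableT_comp mu (measurableT_comp measurable_fst measurable_fst)).
  + apply: (measurableT_comp mmix
      (g := fun q : (T * Y) * n.-tuple R => (q.1.2, q.2))).
    apply/measurable_fun_pairP; split; last exact: measurable_snd.
    exact: (measurableT_comp measurable_snd measurable_fst).
- by move=> q; rewrite lee_fin kappa_ge0 ?tilt_gt0.
Qed.

Let mkH : measurable_fun setT (fun p : T * Y => ((k p.1 p.2)%:E * H p.1 p.2)%E).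
Proof. by apply: emeasurable_funM => //; exact/measurable_EFinP. Qed.

Let kH0 w y : (0 <= (k w y)%:E * H w y)%E.
Proof. by rewrite mule_ge0// lee_fin. Qed.

(** The chain rule, before integration over the parameter [w] and the first
    observation [y]. *)
Lemma integral_kappa_observe w y :
  (\int[G]_z (kappa (observe k u w (y, z)) (marginal P (observe k u) (y, z)))%:E
   = (kappa (k w y) (g y))%:E + (k w y)%:E * H w y)%E.
Proof.
have e0 z : (0 <= (tilt (u w) z)%:E)%E by rewrite lee_fin tilt_ge0.
have m0 z : (0 <= (mixture (post y) u z)%:E)%E by rewrite lee_fin ltW.
have me : measurable_fun setT (fun z => (tilt (u w) z)%:E).
  by apply/measurable_EFinP; exact: measurable_tiltl.
have mm : measurable_fun setT (fun z => (mixture (post y) u z)%:E).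
  by apply/measurable_EFinP; exact: measurable_mixture.
have k0 : 0 <= k w y by [].
have g0 : 0 <= g y by rewrite ltW.
have I (a b : R) : 0 <= a -> 0 <= b ->
   (\int[G]_z ((a * tilt (u w) z)%:E + (b * mixture (post y) u z)%:E) =
    (a + b)%:E)%E.
  move=> a0 b0; under eq_integral do rewrite !EFinM.
  rewrite ge0_integralD//; last 4 first.
  - by move=> z _; rewrite mule_ge0.
  - exact: measurable_funeM.
  - by move=> z _; rewrite mule_ge0.
  - exact: measurable_funeM.
  rewrite !ge0_integralZl_EFin// integral_tilt// integral_mixture//.
  by rewrite !mule1.
have I0 (a b : R) z : 0 <= a -> 0 <= b ->
    (0 <= (a * tilt (u w) z)%:E + (b * mixture (post y) u z)%:E)%E.
  by move=> a0 b0; rewrite !EFinM adde_ge0// mule_ge0.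
have mI (a b : R) : measurable_fun setT
    (fun z => ((a * tilt (u w) z)%:E + (b * mixture (post y) u z)%:E)%E).
  by apply: emeasurable_funD; under eq_fun do rewrite EFinM; exact: measurable_funeM.
have mke : measurable_fun setT
    (fun z => (kappa (tilt (u w) z) (mixture (post y) u z))%:E).
  apply/measurable_EFinP; apply: measurable_kappa => //.
  - exact: measurable_tiltl.
  - exact: measurable_mixture.
have ke0 z : (0 <= (kappa (tilt (u w) z) (mixture (post y) u z))%:E)%E.
  by rewrite lee_fin kappa_ge0 ?tilt_gt0.
have kkg : 0 <= kappa (k w y) (g y) by exact: kappa_ge0.
have E1 : (\int[G]_z (kappa (observe k u w (y, z)) (marginal P (observe k u) (y, z)))%:E
   + (g y + k w y)%:E =
   ((kappa (k w y) (g y))%:E + (k w y)%:E * H w y) + (g y + k w y)%:E)%E.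
  rewrite -{1}(I _ _ g0 k0) -ge0_integralD//; last 3 first.
  - by move=> z _; rewrite lee_fin marginal_observe kappa_ge0 ?observe_gt0 ?mulr_gt0.
  - apply/measurable_EFinP; apply: measurable_kappa.
    + by rewrite /observe/=; apply: measurable_funM => //; exact: measurable_tiltl.
    + by under eq_fun do rewrite marginal_observe; apply: measurable_funM => //; exact: measurable_mixture.
    + by move=> z; rewrite marginal_observe mulr_gt0.
  - by move=> z _; exact: I0.
  transitivity (\int[G]_z (((k w y)%:E * (kappa (tilt (u w) z) (mixture (post y) u z))%:E) +
     (((kappa (k w y) (g y) + k w y) * tilt (u w) z)%:E + (g y * mixture (post y) u z)%:E)))%E.
    apply: eq_integral => z _; rewrite -!EFinM -!EFinD; congr (_%:E).
    have := kappa_chain (k_gt0 w y) (g_gt0 y) (tilt_gt0 (u w) z) (mix_gt0 y z).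
    rewrite marginal_observe /observe/=; lra.
  rewrite ge0_integralD//; last 3 first.
  - by move=> z _; rewrite mule_ge0.
  - exact: measurable_funeM.
  - by move=> z _; apply: I0 => //; exact: addr_ge0.
  have kkg' : 0 <= kappa (k w y) (g y) + k w y by exact: addr_ge0.
  rewrite ge0_integralZl_EFin// I// -/(H w y) [RHS]addeAC [RHS]addeC.
  by congr (_ + _)%E; rewrite -EFinD; congr (_%:E); ring.
exact: adde_fin_inj E1.
Qed.

(** The chain rule: an additional observation of [u] contributes its average
    information under the posterior laws. *)
Lemma information_observe :
  (information P (nu \x G)%E (observe k u) =
   information P nu k + \int[nu]_y ((g y)%:E * gaussian_information (post y) G u))%E.
Proof.
have mkk : measurable_fun setT (fun p : T * Y => (kappa (k p.1 p.2) (g p.2))%:E).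
  apply/measurable_EFinP; apply: measurable_kappa => //.
  exact: measurableT_comp.
have kk0 w y : (0 <= (kappa (k w y) (g y))%:E)%E by rewrite lee_fin kappa_ge0.
transitivity (\int[P]_w (\int[nu]_y (kappa (k w y) (g y))%:E +
    \int[nu]_y ((k w y)%:E * H w y)))%E.
  apply: eq_integral => w _.
  rewrite fubini_tonelli1; last 2 first.
  - have [mo o0 _ _] := statistical_model_observe.
    apply/measurable_EFinP; apply: measurable_kappa.
    + exact: (measurable_fun_pair2 w mo).
    + by apply: measurable_marginal => // w' p; exact: ltW.
    + by move=> [y z]; rewrite marginal_observe mulr_gt0.
  - by move=> [y z]; rewrite lee_fin marginal_observe kappa_ge0 ?observe_gt0 ?mulr_gt0.
  rewrite /fubini_F; under eq_integral do rewrite integral_kappa_observe.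
  rewrite ge0_integralD//.
  - exact: (measurable_fun_pair2 w mkk).
  - exact: (measurable_fun_pair2 w mkH).
rewrite ge0_integralD//; last 4 first.
- by move=> w _; exact: integral_ge0.
- by apply: (@measurable_fun_fubini_tonelli_F _ _ _ _ R nu _ mkk) => p.
- by move=> w _; exact: integral_ge0.
- by apply: (@measurable_fun_fubini_tonelli_F _ _ _ _ R nu _ mkH) => p.
congr (_ + _)%E; rewrite (@fubini_tonelli _ _ _ _ R P nu _ mkH)//=.
apply: eq_integral => y _.
have gN0 : g y != 0 by rewrite gt_eqF.
have -> : gaussian_information (post y) G u =
    (\int[P]_w (H w y * (k w y / g y)%:E))%E.
  exact: (@postP y (H ^~ y) (measurable_fun_pair1 y mH) (H0 ^~ y)).
rewrite -ge0_integralZl_EFin ?(ltW (g_gt0 y))//; last 2 first.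
- by move=> w _; rewrite mule_ge0// lee_fin divr_ge0// ltW.
- apply: emeasurable_funM; first exact: (measurable_fun_pair1 y mH).
  by apply/measurable_EFinP; exact: measurable_funM.
apply: eq_integral => w _; rewrite [RHS]muleCA -EFinM [RHS]muleC; congr (_%:E * _)%E.
by field.
Qed.

Lemma measurable_posterior_information :
  measurable_fun setT (fun y => ((g y)%:E * gaussian_information (post y) G u)%E).
Proof.
apply: emeasurable_funM; first exact/measurable_EFinP.
rewrite (_ : (fun y => gaussian_information _ _ _) =
  fun y => \int[P]_w (H w y * (k w y / g y)%:E))%E.
  apply: (@measurable_fun_fubini_tonelli_G _ _ _ _ R P
    (fun p => H p.1 p.2 * (k p.1 p.2 / g p.2)%:E)%E).
  - apply: emeasurable_funM => //; apply/measurable_EFinP.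
    apply: measurable_funM => //.
    rewrite (_ : (fun _ => _) = fun p : T * Y => g p.2 `^ (-1)).
      apply: (measurableT_comp (measurable_powR (-1))).
      exact: measurableT_comp.
    by apply/funext => p; rewrite powR_inv1// ltW.
  - by move=> p; rewrite mule_ge0// lee_fin divr_ge0// ltW.
apply/funext => y; exact: (@postP y (H ^~ y) (measurable_fun_pair1 y mH) (H0 ^~ y)).
Qed.

End observation.

(** Next to any other observation, observing a contraction [v] of [u] instead of
    [u] can increase the information only by an error quadratic in [B]. *)
Lemma information_observe_contraction u v (B : R) :
  measurable_fun setT u -> measurable_fun setT v ->
  (forall w, dot (u w) (u w) <= B) -> (forall w, dot (v w) (v w) <= B) ->
  4 * B <= 1 ->
  (forall w w', dot (vsub (v w) (v w')) (vsub (v w) (v w')) <=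
                dot (vsub (u w) (u w')) (vsub (u w) (u w'))) ->
  (information P (nu \x G) (observe k v) <=
   information P (nu \x G) (observe k u) + (2 * (4 * B) ^+ 2)%:E)%E.
Proof.
move=> mu mv uB vB B1 vu; set C := 2 * (4 * B) ^+ 2.
have C0 : 0 <= C by rewrite mulr_ge0// sqr_ge0.
have gi0 y (t : T -> n.-tuple R) : measurable_fun setT t ->
    (0 <= gaussian_information (post y) G t)%E.
  move=> mt; apply: integral_ge0 => w _; apply: integral_ge0 => z _.
  by rewrite lee_fin kappa_ge0 ?tilt_gt0 ?mixture_gt0.
have gg0 y : (0 <= (g y)%:E)%E by rewrite lee_fin ltW.
pose h (t : T -> n.-tuple R) y := ((g y)%:E * gaussian_information (post y) G t)%E.
have h0 t y : measurable_fun setT t -> (0 <= h t y)%E.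
  by move=> mt; rewrite mule_ge0// gi0.
have mh t : measurable_fun setT t -> measurable_fun setT (h t).
  exact: measurable_posterior_information.
have mgE : measurable_fun setT (fun y => (g y)%:E) by exact/measurable_EFinP.
have gC : (\int[nu]_y (C%:E * (g y)%:E) = C%:E)%E.
  by rewrite ge0_integralZl_EFin// integral_g mule1.
have key : (\int[nu]_y h v y <= \int[nu]_y h u y + C%:E)%E.
  apply: (@le_trans _ _ (\int[nu]_y (h u y + C%:E * (g y)%:E))%E); last first.
    rewrite ge0_integralD ?gC//.
    - by move=> y _; exact: h0.
    - exact: mh.
    - by move=> y _; rewrite mule_ge0.
    - exact: measurable_funeM.
  apply: ge0_le_integral => //.
  - by move=> y _; exact: h0.
  - exact: mh.
  - by apply: emeasurable_funD; [exact: mh|exact: measurable_funeM].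
  move=> y _; rewrite [X in (_ + X)%E]muleC -ge0_muleDr ?gi0//.
  by apply: lee_wpmul2l => //; exact: gaussian_information_small_contraction.
have aux (x y i a b c : \bar R) : (x = i + a -> y = i + b -> a <= b + c -> x <= y + c)%E.
  by move=> -> -> abc; rewrite -addeA; exact: leeD2l.
exact: aux (information_observe mv) (information_observe mu) key.
Qed.

End chain_rule.

(** * Interpolation between two signals *)

Section two_observations.
Context {R : realType} {n : nat}.
Variable G : probability (n.-tuple R) R.
Hypothesis gaussG : gaussian_measure G.
Local Open Scope ereal_scope.
Local Notation V := (n.-tuple R).

(** Averaging with a fresh noise on the second, or on the first, of two
    independent Gaussian variables. *)
Lemma ge0_integral_rotation2 (al be : R) (F : V * V -> \bar R) :
  (0 < be)%R -> (al ^+ 2 + be ^+ 2 = 1)%R ->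
  measurable_fun setT F -> (forall p, 0 <= F p) ->
  \int[(G \x G) \x G]_q F (q.1.1, vadd (vscale al q.1.2) (vscale be q.2)) =
  \int[G \x G]_p F p.
Proof.
move=> be0 albe mF F0.
have mFr : measurable_fun setT (fun q : (V * V) * V =>
    F (q.1.1, vadd (vscale al q.1.2) (vscale be q.2))).
  apply: (measurableT_comp mF); apply/measurable_fun_pairP; split.
    exact: (measurableT_comp measurable_fst measurable_fst).
  apply: measurable_vadd; apply: measurable_vscale; try exact: measurable_cst.
    exact: (measurableT_comp measurable_snd measurable_fst).
  exact: measurable_snd.
pose GG : probability (V * V)%type R := (G \x G).
pose FG := fubini_F G (fun q : (V * V) * V =>
  F (q.1.1, vadd (vscale al q.1.2) (vscale be q.2))).
have mFG : measurable_fun setT FG.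
  by apply: measurable_fun_fubini_tonelli_F => // q; exact: F0.
have FG0 p : 0 <= FG p by exact: integral_ge0.
transitivity (\int[G \x G]_p FG p).
  exact: (@fubini_tonelli1 _ _ _ _ R GG G _ mFr (fun=> F0 _)).
transitivity (\int[G]_y \int[G]_z FG (y, z)).
  exact: (@fubini_tonelli1 _ _ _ _ R G G _ mFG FG0).
transitivity (\int[G]_y \int[G]_z F (y, z)); last first.
  exact: esym (@fubini_tonelli1 _ _ _ _ R G G _ mF F0).
apply: eq_integral => y _.
apply: (ge0_integral_gaussian_rotation gaussG be0 albe (F := fun z => F (y, z))) => //.
exact: (measurable_fun_pair2 y mF).
Qed.

Lemma ge0_integral_rotation1 (al be : R) (F : V * V -> \bar R) :
  (0 < be)%R -> (al ^+ 2 + be ^+ 2 = 1)%R ->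
  measurable_fun setT F -> (forall p, 0 <= F p) ->
  \int[(G \x G) \x G]_q F (vadd (vscale al q.1.1) (vscale be q.2), q.1.2) =
  \int[G \x G]_p F p.
Proof.
move=> be0 albe mF F0.
have mFr : measurable_fun setT (fun q : (V * V) * V =>
    F (vadd (vscale al q.1.1) (vscale be q.2), q.1.2)).
  apply: (measurableT_comp mF); apply/measurable_fun_pairP; split; last first.
    exact: (measurableT_comp measurable_snd measurable_fst).
  apply: measurable_vadd; apply: measurable_vscale; try exact: measurable_cst.
    exact: (measurableT_comp measurable_fst measurable_fst).
  exact: measurable_snd.
pose GG : probability (V * V)%type R := (G \x G).
pose FG := fubini_F G (fun q : (V * V) * V =>
  F (vadd (vscale al q.1.1) (vscale be q.2), q.1.2)).
have mFG : measurable_fun setT FG.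
  by apply: measurable_fun_fubini_tonelli_F => // q; exact: F0.
have FG0 p : 0 <= FG p by exact: integral_ge0.
transitivity (\int[G \x G]_p FG p).
  exact: (@fubini_tonelli1 _ _ _ _ R GG G _ mFr (fun=> F0 _)).
transitivity (\int[G]_z \int[G]_y FG (y, z)).
  exact: (@fubini_tonelli2 _ _ _ _ R G G _ mFG FG0).
transitivity (\int[G]_z \int[G]_y F (y, z)); last first.
  exact: esym (@fubini_tonelli2 _ _ _ _ R G G _ mF F0).
apply: eq_integral => z _.
apply: (ge0_integral_gaussian_rotation gaussG be0 albe (F := fun y => F (y, z))) => //.
exact: (measurable_fun_pair1 z mF).
Qed.

End two_observations.

Section interpolation.
Context {R : realType} {n : nat} {d} {T : measurableType d}.
Variables (P : probability T R) (G : probability (n.-tuple R) R).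
Hypothesis gaussG : gaussian_measure G.
Implicit Types (u v : T -> n.-tuple R) (a b dt : R).

(** The density of an observation of [u] at the signal-to-noise ratio [a]. *)
Definition scaled_tilt u a w (z : n.-tuple R) := tilt (vscale (Num.sqrt a) (u w)) z.

Lemma measurable_scaled u a : measurable_fun setT u ->
  measurable_fun setT (fun w => vscale (Num.sqrt a) (u w)).
Proof. by move=> mu; apply: measurable_vscale => //; exact: measurable_cst. Qed.

(** Two observations at the ratios [a] and [dt] depend on the signal only
    through one linear combination of them, which is an observation at the
    ratio [a + dt]. *)
Lemma scaled_tiltD u a dt w (x y : n.-tuple R) : 0 <= a -> 0 < dt ->
  scaled_tilt u a w x * scaled_tilt u dt w y =
  scaled_tilt u (a + dt) w
    (vadd (vscale (Num.sqrt a / Num.sqrt (a + dt)) x)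
          (vscale (Num.sqrt dt / Num.sqrt (a + dt)) y)).
Proof.
move=> a0 dt0; rewrite /scaled_tilt /tilt -expRD; congr expR; rewrite !dotE.
have adt0 : 0 < a + dt by rewrite ltr_wpDl.
have sN0 : Num.sqrt (a + dt) != 0 by rewrite gt_eqF// sqrtr_gt0.
have Sa := sqr_sqrtr a0; have Sd := sqr_sqrtr (ltW dt0).
have Sad := sqr_sqrtr (ltW adt0).
rewrite !(mulrA (Num.sqrt a) (Num.sqrt a)) !(mulrA (Num.sqrt dt) (Num.sqrt dt)).
rewrite !(mulrA (Num.sqrt (a + dt)) (Num.sqrt (a + dt))) -!expr2 Sa Sd Sad.
by field.
Qed.

Lemma statistical_model_tilt u : measurable_fun setT u ->
  statistical_model P G (fun w => tilt (u w)).
Proof.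
move=> mu; split.
- by apply: measurable_tilt => //; exact: (measurableT_comp mu).
- by move=> w z; exact: tilt_gt0.
- by move=> w; exact: integral_tilt.
- by move=> z; rewrite -mixtureE// ltry.
Qed.

(** A pair of observations of [u] and [v] at the signal-to-noise ratios [a]
    and [b]. *)
Definition pair_observation u v a b : T -> n.-tuple R * n.-tuple R -> R :=
  observe (scaled_tilt u a) (fun w => vscale (Num.sqrt b) (v w)).

Lemma statistical_model_pair u v a b : measurable_fun setT u -> measurable_fun setT v ->
  statistical_model P (G \x G)%E (pair_observation u v a b).
Proof.
move=> mu mv.
have mod := statistical_model_tilt (measurable_scaled a mu).
have [post postP] := posterior_exists mod.
by apply: (statistical_model_observe gaussG mod postP); exact: measurable_scaled.
Qed.

(** The integrand of the information is measurable and nonnegative. *)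
Lemma statistical_model_kappa d' (Y : measurableType d') (nu : probability Y R)
    (k : T -> Y -> R) w : statistical_model P nu k ->
  measurable_fun setT (fun y => (kappa (k w y) (marginal P k y))%:E) /\
  forall y, (0 <= (kappa (k w y) (marginal P k y))%:E)%E.
Proof.
move=> [mk k0 k1 kP].
have g0 y : 0 < marginal P k y.
  by apply: Rintegral_gt0 => //; exact: (measurable_fun_pair1 y mk).
split=> [|y]; last by rewrite lee_fin kappa_ge0.
apply/measurable_EFinP; apply: measurable_kappa => //.
- exact: (measurable_fun_pair2 w mk).
- by apply: measurable_marginal => // w' y; exact: ltW.
Qed.

Lemma sqrt_ratio a dt : 0 <= a -> 0 < dt ->
  (Num.sqrt a / Num.sqrt (a + dt)) ^+ 2 + (Num.sqrt dt / Num.sqrt (a + dt)) ^+ 2 = 1.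
Proof.
move=> a0 dt0; have adt0 : 0 < a + dt by rewrite ltr_wpDl.
rewrite !exprMn !exprVn !sqr_sqrtr ?(ltW adt0) ?(ltW dt0)//.
by rewrite -mulrDl divff// gt_eqF.
Qed.

(** Observing [v] once more at the ratio [dt] raises its ratio by [dt]. *)
Lemma information_observe2 u v a b dt : measurable_fun setT u -> measurable_fun setT v ->
  0 <= a -> 0 <= b -> 0 < dt ->
  (information P ((G \x G) \x G)
     (observe (pair_observation u v a b) (fun w => vscale (Num.sqrt dt) (v w))) =
   information P (G \x G) (pair_observation u v a (b + dt)))%E.
Proof.
move=> mu mv a0 b0 dt0; have bdt0 : 0 < b + dt by rewrite ltr_wpDl.
pose K := pair_observation u v a (b + dt).
pose rot (q : (n.-tuple R * n.-tuple R) * n.-tuple R) := (q.1.1,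
  vadd (vscale (Num.sqrt b / Num.sqrt (b + dt)) q.1.2)
       (vscale (Num.sqrt dt / Num.sqrt (b + dt)) q.2)).
have obsE w q : observe (pair_observation u v a b)
    (fun w => vscale (Num.sqrt dt) (v w)) w q = K w (rot q).
  rewrite /K /pair_observation /observe/= -mulrA; congr (_ * _).
  exact: (scaled_tiltD v w _ _ b0 dt0).
apply: eq_integral => w _.
have [mk k0] := statistical_model_kappa w (statistical_model_pair a (b + dt) mu mv).
have be0 : 0 < Num.sqrt dt / Num.sqrt (b + dt) by rewrite divr_gt0// sqrtr_gt0.
transitivity (\int[(G \x G) \x G]_q
    (kappa (K w (rot q)) (marginal P K (rot q)))%:E)%E.
  have margE q : marginal P (observe (pair_observation u v a b)
      (fun w => vscale (Num.sqrt dt) (v w))) q = marginal P K (rot q).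
    by apply: eq_Rintegral => w' _; exact: obsE.
  by apply: eq_integral => q _; rewrite -margE -obsE.
exact: (ge0_integral_rotation2 gaussG be0 (sqrt_ratio b0 dt0) mk k0).
Qed.

Lemma information_observe1 u v a b dt : measurable_fun setT u -> measurable_fun setT v ->
  0 <= a -> 0 <= b -> 0 < dt ->
  (information P ((G \x G) \x G)
     (observe (pair_observation u v a b) (fun w => vscale (Num.sqrt dt) (u w))) =
   information P (G \x G) (pair_observation u v (a + dt) b))%E.
Proof.
move=> mu mv a0 b0 dt0; have adt0 : 0 < a + dt by rewrite ltr_wpDl.
pose K := pair_observation u v (a + dt) b.
pose rot (q : (n.-tuple R * n.-tuple R) * n.-tuple R) := (
  vadd (vscale (Num.sqrt a / Num.sqrt (a + dt)) q.1.1)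
       (vscale (Num.sqrt dt / Num.sqrt (a + dt)) q.2), q.1.2).
have obsE w q : observe (pair_observation u v a b)
    (fun w => vscale (Num.sqrt dt) (u w)) w q = K w (rot q).
  rewrite /K /pair_observation /observe/= mulrAC; congr (_ * _).
  exact: (scaled_tiltD u w _ _ a0 dt0).
apply: eq_integral => w _.
have [mk k0] := statistical_model_kappa w (statistical_model_pair (a + dt) b mu mv).
have be0 : 0 < Num.sqrt dt / Num.sqrt (a + dt) by rewrite divr_gt0// sqrtr_gt0.
transitivity (\int[(G \x G) \x G]_q
    (kappa (K w (rot q)) (marginal P K (rot q)))%:E)%E.
  have margE q : marginal P (observe (pair_observation u v a b)
      (fun w => vscale (Num.sqrt dt) (u w))) q = marginal P K (rot q).
    by apply: eq_Rintegral => w' _; exact: obsE.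
  by apply: eq_integral => q _; rewrite -margE -obsE.
exact: (ge0_integral_rotation1 gaussG be0 (sqrt_ratio a0 dt0) mk k0).
Qed.

Lemma scaled_tilt1 u w z : scaled_tilt u 1 w z = tilt (u w) z.
Proof.
rewrite /scaled_tilt sqrtr1 (_ : vscale 1 (u w) = u w)//.
by apply: eq_from_tnth => i; rewrite tnth_mktuple mul1r.
Qed.

Lemma scaled_tilt0 u w z : scaled_tilt u 0 w z = 1.
Proof. by rewrite /scaled_tilt sqrtr0 /tilt !dotE !(mul0r, subr0, mulr0) expR0. Qed.

Lemma information_pair10 u v : measurable_fun setT u -> measurable_fun setT v ->
  information P (G \x G)%E (pair_observation u v 1 0) = gaussian_information P G u.
Proof.
move=> mu mv; apply: eq_integral => w _.
have [mk k0] := statistical_model_kappa w (statistical_model_pair 1 0 mu mv).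
have pE w' p : pair_observation u v 1 0 w' p = tilt (u w') p.1.
  by rewrite /pair_observation /observe -/(scaled_tilt v 0 w' p.2) scaled_tilt0 mulr1 scaled_tilt1.
rewrite fubini_tonelli1//; apply: eq_integral => y _; rewrite /fubini_F.
rewrite -[RHS](integral_probability_cst G); apply: eq_integral => z _.
rewrite pE; congr (kappa _ _)%:E; rewrite /marginal /mixture.
by apply: eq_Rintegral => w' _; rewrite pE.
Qed.

Lemma information_pair01 u v : measurable_fun setT u -> measurable_fun setT v ->
  information P (G \x G)%E (pair_observation u v 0 1) = gaussian_information P G v.
Proof.
move=> mu mv; apply: eq_integral => w _.
have [mk k0] := statistical_model_kappa w (statistical_model_pair 0 1 mu mv).
have pE w' p : pair_observation u v 0 1 w' p = tilt (v w') p.2.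
  by rewrite /pair_observation /observe scaled_tilt0 mul1r -/(scaled_tilt v 1 w' p.2) scaled_tilt1.
rewrite fubini_tonelli2//; apply: eq_integral => z _; rewrite /fubini_G.
rewrite -[RHS](integral_probability_cst G); apply: eq_integral => y _.
rewrite pE; congr (kappa _ _)%:E; rewrite /marginal /mixture.
by apply: eq_Rintegral => w' _; rewrite pE.
Qed.

Section bounded.
Variables (u v : T -> n.-tuple R) (B : R).
Hypotheses (mu : measurable_fun setT u) (mv : measurable_fun setT v).
Hypothesis uB : forall w, dot (u w) (u w) <= B.
Hypothesis vB : forall w, dot (v w) (v w) <= B.
Hypothesis vu : forall w w', dot (vsub (v w) (v w')) (vsub (v w) (v w')) <=
                dot (vsub (u w) (u w')) (vsub (u w) (u w')).

Let Phi a b := information P (G \x G)%E (pair_observation u v a b).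

(** Both sides add one observation to the same pair: of [v] on the left, of [u]
    on the right. *)
Lemma pair_information_step a b dt : 0 <= a -> 0 <= b -> 0 < dt -> 4 * (dt * B) <= 1 ->
  (Phi a (b + dt) <= Phi (a + dt) b + (2 * (4 * (dt * B)) ^+ 2)%:E)%E.
Proof.
move=> a0 b0 dt0 B1.
rewrite /Phi -information_observe2// -information_observe1//.
have mod := statistical_model_pair a b mu mv.
have [post postP] := posterior_exists mod.
have Sd := sqr_sqrtr (ltW dt0).
have subE (t : T -> n.-tuple R) w w' :
    dot (vsub (vscale (Num.sqrt dt) (t w)) (vscale (Num.sqrt dt) (t w')))
        (vsub (vscale (Num.sqrt dt) (t w)) (vscale (Num.sqrt dt) (t w'))) =
    dt * dot (vsub (t w) (t w')) (vsub (t w) (t w')).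
  rewrite !dotE !(mulrA (Num.sqrt dt) (Num.sqrt dt)) -!expr2 Sd; ring.
apply: (information_observe_contraction gaussG mod postP) => //.
- exact: measurable_scaled.
- exact: measurable_scaled.
- by move=> w; rewrite !dotE mulrA -expr2 Sd ler_pM2l.
- by move=> w; rewrite !dotE mulrA -expr2 Sd ler_pM2l.
- by move=> w w'; rewrite !subE ler_pM2l.
Qed.

(** The theorem on informations, for bounded signals. *)
Lemma gaussian_information_bounded_contraction :
  (gaussian_information P G v <= gaussian_information P G u)%E.
Proof.
have B0 : 0 <= B by exact: le_trans (dot_ge0 _) (uB point).
rewrite -(information_pair01 mu mv) -(information_pair10 mu mv) -/(Phi 0 1) -/(Phi 1 0).
apply/lee_addgt0Pr => e e0.
(* With N steps of length 1 / N, the step size is admissible once N >= 4 * B and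
   the total error is N * 2 * (4 * B / N) ^ 2 = 32 * B ^ 2 / N. *)
pose N := (Num.trunc (4 * B + 32 * B ^+ 2 / e)).+1.
have N0 : 0 < N%:R :> R by rewrite ltr0n.
have NB : 4 * B + 32 * B ^+ 2 / e < N%:R by exact: truncnS_gt.
have q0 : 0 <= 32 * B ^+ 2 / e by rewrite divr_ge0 ?mulr_ge0 ?sqr_ge0// ltW.
pose dt : R := N%:R^-1.
have dt0 : 0 < dt by rewrite invr_gt0.
have dtN : N%:R * dt = 1 by rewrite divff// gt_eqF.
have B1 : 4 * (dt * B) <= 1.
  by rewrite mulrCA -ler_pdivlMl ?invr_gt0// invrK mulr1; lra.
pose C := 2 * (4 * (dt * B)) ^+ 2.
have step j : (j <= N)%N ->
    (Phi (1 - j%:R * dt) (j%:R * dt) <= Phi 1 0 + (j%:R * C)%:E)%E.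
  elim: j => [_|j IH jN]; first by rewrite !mul0r subr0 adde0.
  have := IH (ltnW jN); move=> {}IH.
  have a0 : 0 <= 1 - j.+1%:R * dt.
    by rewrite subr_ge0 -[leRHS]dtN ler_pM2r// ler_nat.
  have b0 : 0 <= j%:R * dt by rewrite mulr_ge0// ltW.
  have := pair_information_step a0 b0 dt0 B1.
  have -> : j%:R * dt + dt = j.+1%:R * dt by rewrite -natr1 mulrDl mul1r.
  have -> : 1 - j.+1%:R * dt + dt = 1 - j%:R * dt by rewrite -natr1; ring.
  have aux (x y z : \bar R) : (x <= y + C%:E -> y <= z + (j%:R * C)%:E ->
      x <= z + (j.+1%:R * C)%:E)%E.
    have -> : j.+1%:R * C = j%:R * C + C by rewrite -natr1; ring.
    by move=> xy yz; rewrite EFinD addeA (le_trans xy)// leeD2r.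
  by move=> xy; exact: aux xy IH.
have := step N (leqnn N); rewrite dtN subrr => stepN.
apply: (le_trans stepN); apply: leeD2l; rewrite lee_fin /C.
have -> : N%:R * (2 * (4 * (dt * B)) ^+ 2) = (N%:R * dt) * (32 * B ^+ 2 * dt) by ring.
rewrite dtN mul1r ler_pdivrMr// -ler_pdivrMl// (mulrC e^-1); apply/ltW.
by apply: le_lt_trans NB; rewrite lerDr mulr_ge0.
Qed.

End bounded.
End interpolation.

(** * Truncation *)

Section truncation.
Context {R : realType} {n : nat} {d} {T : measurableType d}.
Variables (P : probability T R) (G : probability (n.-tuple R) R).
Hypothesis gaussG : gaussian_measure G.
Variables (A : set T) (mA : measurable A).
Implicit Types t u v : T -> n.-tuple R.

(** The mixture of the densities of [t + Z] under the law [P] conditioned on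
    the event [A]. *)
Definition conditional_mixture t z : R :=
  (fine (P A))^-1 * \int[P]_w (\1_A w * tilt (t w) z).

Let p := fine (P A).
Hypothesis p0 : 0 < p.

Let pE : (P A = p%:E)%E.
Proof. by rewrite /p fineK// fin_num_measure. Qed.

Let mI : measurable_fun setT (\1_A : T -> R).
Proof. exact: measurable_indic. Qed.

Let I0 w : 0 <= (\1_A w : R).
Proof. by rewrite indicE ler0n. Qed.

(** The law [Q] conditioned on [A]: an integral under [Q] depends only on the
    values of the integrand on [A]. *)
Let conditional_exists : exists Q : probability T R, forall H H' : T -> \bar R,
  measurable_fun setT H -> measurable_fun setT H' ->
  (forall w, 0 <= H w)%E -> (forall w, 0 <= H' w)%E ->
  (forall w, A w -> H' w = H w) ->
  (p%:E * \int[Q]_w H' w = \int[P]_w ((\1_A w)%:E * H w))%E.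
Proof.
have [||| Q QE] := @probability_density _ T R P (fun w => \1_A w / p).
- exact: measurable_funM.
- by move=> w; rewrite divr_ge0// ltW.
- under eq_integral do rewrite mulrC EFinM.
  rewrite ge0_integralZl_EFin ?invr_ge0//; last 2 first.
  + exact/measurable_EFinP.
  + exact: ltW.
  have -> : (\int[P]_w (\1_A w)%:E = p%:E)%E.
    by rewrite integral_indic// setIT; exact: pE.
  by rewrite -EFinM mulVf// gt_eqF.
exists Q => H H' mH mH' H0 H'0 HH'; rewrite QE//.
rewrite -ge0_integralZl_EFin ?(ltW p0)//; last 2 first.
- by move=> w _; rewrite mule_ge0// lee_fin divr_ge0// ltW.
- apply: emeasurable_funM => //; apply/measurable_EFinP.
  exact: measurable_funM.
apply: eq_integral => w _; rewrite indicE.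
have [/set_mem Aw|_] := boolP (w \in A); last by rewrite mul0r !mule0 mul0e.
rewrite HH'// mul1e muleCA -EFinM div1r divff ?mule1//.
by rewrite gt_eqF.
Qed.

Let A_nonempty : exists w, A w.
Proof.
apply: contrapT => nA; move: p0; rewrite /p (_ : A = set0) ?measure0 ?ltxx//.
by apply/seteqP; split => // w Aw; apply: nA; exists w.
Qed.

(** The information on [v] under the law conditioned on [A], weighted by the
    probability of [A], is at most the unconditional information on [u]. *)
Lemma conditional_information_le u v (B : R) :
  measurable_fun setT u -> measurable_fun setT v ->
  (forall w, A w -> dot (u w) (u w) <= B) ->
  (forall w, A w -> dot (v w) (v w) <= B) ->
  (forall w w', dot (vsub (v w) (v w')) (vsub (v w) (v w')) <=
                dot (vsub (u w) (u w')) (vsub (u w) (u w'))) ->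
  [/\ measurable_fun setT (conditional_mixture v),
      forall z, 0 < conditional_mixture v z &
      (\int[P]_w \int[G]_z (\1_A w * kappa (tilt (v w) z) (conditional_mixture v z))%:E
       <= gaussian_information P G u)%E].
Proof.
move=> mu mv uB vB vu.
have [Q QE] := conditional_exists.
have [w0 Aw0] := A_nonempty.
(* Outside of A, which is negligible for Q, the parameter is moved to a point
   of A, so that the signals become bounded everywhere. *)
pose tau w := if w \in A then w else w0.
have tauA w : A (tau w) by rewrite /tau; case: ifPn => // /set_mem.
have tauE w : A w -> tau w = w by move=> Aw; rewrite /tau mem_set.
have mtau : measurable_fun setT tau.
  move=> _ Y mY; rewrite setTI.
  rewrite (_ : tau @^-1` Y = (A `&` Y) `|` (~` A `&` [set _ | Y w0])).
    apply: measurableU; apply: measurableI => //; first exact: measurableC.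
    have [Yw0|nYw0] := pselect (Y w0).
      by rewrite (_ : [set _ | _] = setT)//; apply/seteqP; split.
    by rewrite (_ : [set _ | _] = set0)//; apply/seteqP; split.
  apply/seteqP; split => w /=; rewrite /tau.
    by case: ifPn => [/set_mem|/negP wA]; [left|right; split => // Aw; apply: wA; exact: mem_set].
  by case: ifPn => [/set_mem Aw|/negP wA] [[]|[]]//; move=> Aw; case: wA; exact: mem_set.
pose u' w := u (tau w); pose v' w := v (tau w).
have mu' : measurable_fun setT u' by exact: (measurableT_comp mu mtau).
have mv' : measurable_fun setT v' by exact: (measurableT_comp mv mtau).
have cmE z : conditional_mixture v z = mixture Q v' z.
  apply: (@mulfI _ p); first by rewrite gt_eqF.
  apply: EFin_inj; rewrite [RHS]EFinM mixtureE//.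
  rewrite (QE (fun w => (tilt (v w) z)%:E))//; last 5 first.
  - by apply/measurable_EFinP; exact: measurable_tiltr.
  - by apply/measurable_EFinP; exact: measurable_tiltr.
  - by move=> w; rewrite lee_fin tilt_ge0.
  - by move=> w; rewrite lee_fin tilt_ge0.
  - by move=> w Aw; rewrite /v' tauE.
  rewrite /conditional_mixture mulrA divff ?gt_eqF// mul1r.
  rewrite EFin_bounded_Rintegral//; apply: bounded_mfunM; last exact: bounded_tilt.
  by split; [exact: mI|exists 1 => w; rewrite ger0_norm ?I0// indicE lern1 leq_b1].
have mcm : measurable_fun setT (conditional_mixture v).
  rewrite (_ : conditional_mixture v = mixture Q v'); last exact/funext.
  exact: measurable_mixture.
have cm0 z : 0 < conditional_mixture v z by rewrite cmE mixture_gt0.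
have vu' w w' : dot (vsub (v' w) (v' w')) (vsub (v' w) (v' w')) <=
                dot (vsub (u' w) (u' w')) (vsub (u' w) (u' w')) by exact: vu.
have uB' w : dot (u' w) (u' w) <= B by exact: uB.
have vB' w : dot (v' w) (v' w) <= B by exact: vB.
have infoQ := gaussian_information_bounded_contraction Q gaussG mu' mv' uB' vB' vu'.
split=> //.
(* Divergences from a density [g], as functions of the parameter. *)
have mK t (g : n.-tuple R -> R) : measurable_fun setT t -> measurable_fun setT g ->
    (forall z, 0 < g z) ->
    measurable_fun setT (fun q : T * n.-tuple R => (kappa (tilt (t q.1) q.2) (g q.2))%:E).
  move=> mt mg g0; apply/measurable_EFinP; apply: measurable_kappa => //.
  - by apply: measurable_tilt; [exact: (measurableT_comp mt measurable_fst)|exact: measurable_snd].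
  - exact: (measurableT_comp mg measurable_snd).
have K0 t (g : n.-tuple R -> R) w z : (forall z, 0 < g z) ->
    (0 <= (kappa (tilt (t w) z) (g z))%:E)%E.
  by move=> g0; rewrite lee_fin kappa_ge0 ?tilt_gt0.
pose D t (g : n.-tuple R -> R) w : \bar R :=
  (\int[G]_z (kappa (tilt (t w) z) (g z))%:E)%E.
have D0 t (g : n.-tuple R -> R) w : (forall z, 0 < g z) -> (0 <= D t g w)%E.
  by move=> g0; apply: integral_ge0 => z _; exact: K0.
have mD t (g : n.-tuple R -> R) : measurable_fun setT t -> measurable_fun setT g ->
    (forall z, 0 < g z) -> measurable_fun setT (D t g).
  move=> mt mg g0; apply: (@measurable_fun_fubini_tonelli_F _ _ _ _ R G _ (mK _ _ mt mg g0)).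
  by move=> q; exact: K0.
have mixP0 z : 0 < mixture P u z by exact: mixture_gt0.
have mmixP : measurable_fun setT (mixture P u) by exact: measurable_mixture.
have p0' : (0 <= p%:E)%E by rewrite lee_fin ltW.
have step1 : (\int[P]_w \int[G]_z
    (\1_A w * kappa (tilt (v w) z) (conditional_mixture v z))%:E =
    p%:E * gaussian_information Q G v')%E.
  transitivity (\int[P]_w ((\1_A w)%:E * D v (conditional_mixture v) w))%E.
    apply: eq_integral => w _; rewrite /D -ge0_integralZl_EFin//.
    - by move=> z _; exact: K0.
    - exact: (measurable_fun_pair2 w (mK _ _ mv mcm cm0)).
  transitivity (p%:E * \int[Q]_w D v' (conditional_mixture v) w)%E.
    symmetry; apply: (QE (D v _) (D v' _)).
    - exact: mD.
    - exact: mD.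
    - by move=> w; exact: D0.
    - by move=> w; exact: D0.
    - by move=> w Aw; rewrite /D /v' tauE.
  have -> : conditional_mixture v = mixture Q v' by exact/funext.
  by [].
(* The mixture under Q minimises the average divergence. *)
have step2 : (gaussian_information Q G u' <= \int[Q]_w D u' (mixture P u) w)%E.
  have swapP : (\int[Q]_w D u' (mixture P u) w =
      \int[G]_z \int[Q]_w (kappa (tilt (u' w) z) (mixture P u z))%:E)%E.
    apply: (@fubini_tonelli _ _ _ _ R Q G _ (mK _ _ mu' mmixP mixP0)).
    by move=> q; exact: K0.
  rewrite [leLHS](gaussian_informationE Q G mu') [leRHS]swapP.
  have mKQ := measurable_kappa_mixture Q mu'.
  have mKP : measurable_fun setT (fun q : n.-tuple R * T =>
      (kappa (tilt (u' q.2) q.1) (mixture P u q.1))%:E).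
    apply/measurable_EFinP; apply: measurable_kappa => //.
    - exact: measurable_tilt_pair.
    - exact: (measurableT_comp mmixP measurable_fst).
  apply: ge0_le_integral => //.
  - by move=> z _; apply: integral_ge0 => w _; rewrite lee_fin kappa_ge0 ?tilt_gt0 ?mixture_gt0.
  - apply: (@measurable_fun_fubini_tonelli_F _ _ _ _ R Q _ mKQ) => q.
    by rewrite lee_fin kappa_ge0 ?tilt_gt0 ?mixture_gt0.
  - apply: (@measurable_fun_fubini_tonelli_F _ _ _ _ R Q _ mKP) => q.
    by rewrite lee_fin kappa_ge0 ?tilt_gt0.
  move=> z _.
  have comp := @integral_kappa_compensation _ T R Q (fun w => tilt (u' w) z)
    (mixture Q u' z) (mixture P u z) (measurable_tiltr z mu')
    (fun w => tilt_gt0 (u' w) z) (mixP0 z) (mixture_gt0 Q z mu')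
    (esym (mixtureE Q z mu')).
  by rewrite -comp leeDl// lee_fin kappa_ge0 ?mixture_gt0.
have step3 : (p%:E * \int[Q]_w D u' (mixture P u) w <= gaussian_information P G u)%E.
  have -> : (p%:E * \int[Q]_w D u' (mixture P u) w =
      \int[P]_w ((\1_A w)%:E * D u (mixture P u) w))%E.
    apply: (QE (D u _) (D u' _)).
    - exact: mD.
    - exact: mD.
    - by move=> w; exact: D0.
    - by move=> w; exact: D0.
    - by move=> w Aw; rewrite /D /u' tauE.
  apply: ge0_le_integral => //.
  - by move=> w _; rewrite mule_ge0 ?D0// lee_fin.
  - by apply: emeasurable_funM; [exact/measurable_EFinP|exact: mD].
  - exact: mD.
  move=> w _; rewrite indicE; case: (w \in A); rewrite ?mul1e ?mul0e//.
  exact: D0.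
have aux (x y a b c : \bar R) :
    (x = p%:E * a -> a <= b -> b <= c -> p%:E * c <= y -> x <= y)%E.
  by move=> -> ab bc; apply: le_trans; apply: lee_wpmul2l => //; exact: le_trans bc.
exact: aux step1 infoQ step2 step3.
Qed.

End truncation.

Section exhaustion.
Context {R : realType} {n : nat} {d} {T : measurableType d}.
Variable P : probability T R.

Lemma cvg_kappa (k g : R) (g_ : R^nat) : 0 < k -> 0 < g -> g_ N @[N --> \oo] --> g ->
  kappa k (g_ N) @[N --> \oo] --> kappa k g.
Proof.
move=> k0 g0 gg; apply: cvgD => //; apply: cvgB; last exact: cvg_cst.
apply: cvgM; first exact: cvg_cst.
apply: continuous_cvg; first by apply: continuous_ln; rewrite divr_gt0.
by apply: cvgM; [exact: cvg_cst|apply: cvgV => //; rewrite gt_eqF].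
Qed.

Lemma limn_einf_le (x : (\bar R)^nat) (M : \bar R) :
  (forall N, (x N <= M)%E) -> (limn_einf x <= M)%E.
Proof.
move=> xM; rewrite limn_einf_lim; apply: lime_le; first exact: is_cvg_einfs.
apply: nearW => N; apply: le_trans (xM N).
by apply: ereal_inf_lbound; exists N => //=.
Qed.

(** Events [A N] that eventually contain every point. *)
Variable A : (set T)^nat.
Hypothesis mA : forall N, measurable (A N).
Hypothesis evA : forall w, \forall N \near \oo, A N w.

Lemma cvg_Rintegral_indic (h : T -> R) : bounded_mfun h ->
  \int[P]_w (\1_(A N) w * h w) @[N --> \oo] --> \int[P]_w h w.
Proof.
move=> bh; have [mh [M hM]] := bh.
have hg : bounded_mfun (cst M : T -> R) by exact: bounded_mfun_cst.
have mI N : measurable_fun setT (\1_(A N) : T -> R) by exact: measurable_indic.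
have K : (\int[P]_w (\1_(A N) w * h w)%:E @[N --> \oo] --> \int[P]_w (h w)%:E)%E.
  apply: (@dominated_cvg _ T R P setT measurableT _ _ (fun=> M%:E)) => //.
  - by move=> N; apply/measurable_EFinP; exact: measurable_funM.
  - move=> w _; apply: cvg_near_cst; near=> N.
    rewrite indicE mem_set ?mul1r//; near: N; exact: evA.
  - exact: (bounded_mfun_integrable P hg).
  - move=> N w _; rewrite lee_fin normrM indicE.
    by case: (w \in A N); rewrite ?normr1 ?normr0 ?mul1r ?mul0r// (le_trans _ (hM w)).
move: K; rewrite -EFin_bounded_Rintegral// => /fine_cvg; exact.
Unshelve. all: by end_near. Qed.

Lemma cvg_measure_indic : fine (P (A N)) @[N --> \oo] --> (1 : R).
Proof.
have K := cvg_Rintegral_indic (@bounded_mfun_cst _ T R 1).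
rewrite -[X in _ --> X](bounded_Rintegral_cst P 1).
rewrite (_ : (fun N => fine (P (A N))) = fun N => \int[P]_w (\1_(A N) w * 1))//.
apply/funext => N; rewrite /Rintegral; under eq_integral do rewrite mulr1.
by rewrite integral_indic// setIT.
Qed.

Lemma cvg_conditional_mixture (t : T -> n.-tuple R) z : measurable_fun setT t ->
  conditional_mixture P (A N) t z @[N --> \oo] --> mixture P t z.
Proof.
move=> mt; rewrite -[mixture P t z]mul1r -[X in X * mixture P t z]invr1.
apply: cvgM; last by apply: cvg_Rintegral_indic; exact: bounded_tilt.
by apply: cvgV; [rewrite oner_eq0|exact: cvg_measure_indic].
Qed.

End exhaustion.

Section contraction.
Context {R : realType} {n : nat} {d} {T : measurableType d}.
Variables (P : probability T R) (G : probability (n.-tuple R) R).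
Hypothesis gaussG : gaussian_measure G.

(** A contraction of the signal decreases the information. *)
Lemma gaussian_information_contraction (u v : T -> n.-tuple R) :
  measurable_fun setT u -> measurable_fun setT v ->
  (forall w w', dot (vsub (v w) (v w')) (vsub (v w) (v w')) <=
                dot (vsub (u w) (u w')) (vsub (u w) (u w'))) ->
  (gaussian_information P G v <= gaussian_information P G u)%E.
Proof.
move=> mu mv vu.
pose A0 N := [set w | dot (u w) (u w) <= N%:R /\ dot (v w) (v w) <= N%:R].
have mA0 N : measurable (A0 N).
  have mle (t : T -> n.-tuple R) : measurable_fun setT t ->
      measurable [set w | dot (t w) (t w) <= N%:R].
    move=> mt; rewrite -[X in measurable X]setTI.
    rewrite (_ : [set w | _] = (fun w => dot (t w) (t w)) @^-1` `]-oo, N%:R]).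
      exact: (measurable_dot mt mt).
    by apply/seteqP; split => w /=; rewrite in_itv.
  by apply: measurableI; exact: mle.
have evA0 w : \forall N \near \oo, A0 N w.
  near=> N; split; near: N; exact: nbhs_infty_ger.
(* The conditional laws make sense from some rank N0 on. *)
have [N0 _ N0P] : \forall N \near \oo, 0 < fine (P (A0 N)).
  exact: (cvgr_gt _ (cvg_measure_indic P mA0 evA0) _ ltr01).
pose A N := A0 (N + N0)%N.
have mA N : measurable (A N) by exact: mA0.
have evA w : \forall N \near \oo, A N w.
  have [N1 _ N1P] := evA0 w; exists N1 => // N /= N1N; apply: N1P => /=.
  exact: leq_trans (leq_addr _ _).
have pA N : 0 < fine (P (A N)) by apply: N0P; exact: leq_addl.
pose g N := conditional_mixture P (A N) v.
have bound N : [/\ measurable_fun setT (g N), forall z, 0 < g N z &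
    (\int[P]_w \int[G]_z (\1_(A N) w * kappa (tilt (v w) z) (g N z))%:E
       <= gaussian_information P G u)%E].
  apply: (conditional_information_le gaussG (mA N) (pA N) mu mv (B := (N + N0)%:R)) => //.
  - by move=> w [].
  - by move=> w [].
pose f N (q : T * n.-tuple R) : \bar R :=
  (\1_(A N) q.1 * kappa (tilt (v q.1) q.2) (g N q.2))%:E.
have f0 N q : (0 <= f N q)%E.
  have [_ gN0 _] := bound N.
  by rewrite lee_fin mulr_ge0 ?kappa_ge0 ?tilt_gt0// indicE ler0n.
have mf N : measurable_fun setT (f N).
  have [mg gN0 _] := bound N.
  apply/measurable_EFinP; apply: measurable_funM.
    have mI : measurable_fun setT (\1_(A N) : T -> R) by exact: measurable_indic.
    exact: (measurableT_comp mI measurable_fst).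
  apply: measurable_kappa => //.
  - by apply: measurable_tilt; [exact: (measurableT_comp mv measurable_fst)|exact: measurable_snd].
  - exact: (measurableT_comp mg measurable_snd).
pose K (q : T * n.-tuple R) : \bar R := (kappa (tilt (v q.1) q.2) (mixture P v q.2))%:E.
have K0 q : (0 <= K q)%E by rewrite lee_fin kappa_ge0 ?tilt_gt0 ?mixture_gt0.
have mK : measurable_fun setT K.
  apply/measurable_EFinP; apply: measurable_kappa.
  - by apply: measurable_tilt; [exact: (measurableT_comp mv measurable_fst)|exact: measurable_snd].
  - exact: (measurableT_comp (measurable_mixture P mv) measurable_snd).
  - by move=> q; exact: mixture_gt0.
have cvgf q : f N q @[N --> \oo] --> K q.
  apply: cvg_EFin; first by apply: nearW.
  rewrite -[X in _ --> X]mul1r.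
  apply: (@cvgM _ _ _ _ (fun N => \1_(A N) q.1 : R)
    (fun N => kappa (tilt (v q.1) q.2) (g N q.2))).
    apply: cvg_near_cst; have := evA q.1; apply: filterS => N AN.
    by rewrite indicE mem_set.
  apply: cvg_kappa; [exact: tilt_gt0|exact: mixture_gt0|].
  exact: cvg_conditional_mixture.
have infoE : (gaussian_information P G v = \int[(P \x G)%E]_q K q)%E.
  exact: (esym (@fubini_tonelli1 _ _ _ _ R P G _ mK K0)).
have fle N : (\int[(P \x G)%E]_q f N q <= gaussian_information P G u)%E.
  have [_ _] := bound N.
  have -> : (\int[(P \x G)%E]_q f N q = \int[P]_w \int[G]_z f N (w, z))%E.
    exact: (@fubini_tonelli1 _ _ _ _ R P G _ (mf N) (f0 N)).
  exact.
have fat := @fatou _ _ _ (P \x G)%E setT measurableT f mf (fun N q _ => f0 N q).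
have aux (x a b c : \bar R) : (x = a -> a = b -> b <= c -> x <= c)%E.
  by move=> -> ->.
apply: (aux _ _ _ _ infoE _ (le_trans fat (limn_einf_le fle))).
apply: eq_integral => q _; apply/esym.
by rewrite is_cvg_limn_einfE; [exact/cvg_lim|apply/cvg_ex; exists (K q)].
Unshelve. all: by end_near. Qed.

End contraction.

(** * Lipschitz maps are measurable *)

Section lipschitz_measurable.
Context {R : realType} {n : nat}.
Implicit Types x y : n.-tuple R.

(** Rational points are dense for the Euclidean norm. *)
Lemma ratr_tuple_dense x (e : R) : 0 < e ->
  exists q : n.-tuple rat, enorm (vsub x [tuple ratr (tnth q i) | i < n]) < e.
Proof.
move=> e0.
have [h h0 eE] : exists2 h : R, 0 < h & e = h * n.+1%:R.
  by exists (e / n.+1%:R); rewrite ?divr_gt0// divfK// gt_eqF// ltr0n.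
(* Coordinates at distance less than e / (n + 1) suffice; n may be 0. *)
have near i : exists q : rat, `|tnth x i - ratr q| < h.
  have : tnth x i - h < tnth x i + h by lra.
  move=> /rat_in_itvoo[q]; rewrite in_itv/= => /andP[q1 q2].
  by exists q; rewrite ltr_norml; lra.
have [q qP] := choice near.
exists [tuple q i | i < n].
rewrite -(@ltr_pXn2r _ 2)// ?nnegrE ?enorm_ge0 ?(ltW e0)// enorm_sq.
apply: (@le_lt_trans _ _ (\sum_(i < n) h ^+ 2)).
  apply: ler_sum => i _; rewrite !tnth_mktuple -expr2 -real_normK ?num_real//.
  by rewrite lerXn2r ?nnegrE ?normr_ge0 ?(ltW h0)// ltW.
rewrite sumr_const card_ord -[ltLHS]mulr_natr eE exprMn.
rewrite ltr_pM2l ?exprn_gt0// expr2 -natrM ltr_nat.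
by rewrite (leq_trans (ltnSn n))// leq_pmulr.
Qed.

Lemma le_tnth_enorm x i : `|tnth x i| <= enorm x.
Proof.
rewrite -(@ler_pXn2r _ 2)// ?nnegrE ?enorm_ge0 ?normr_ge0//.
rewrite real_normK ?num_real// enorm_sq /dot (bigD1 i)//= -expr2 lerDl.
by apply: sumr_ge0 => j _; rewrite -expr2 sqr_ge0.
Qed.

(** The coordinates of a Lipschitz map are infima of countably many functions
    [x |-> T_i (r) + |x - r|], over the rational points [r]. *)
Lemma measurable_one_lipschitz (T : n.-tuple R -> n.-tuple R) :
  one_lipschitz T -> measurable_fun setT T.
Proof.
move=> lipT; apply/measurable_fun_tnthP => i.
apply: (measurability _ (RGenInftyO.measurableE R)) => //.
move=> /= _ [_ [c ->] <-]; rewrite setTI.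
pose r (q : n.-tuple rat) : n.-tuple R := [tuple ratr (tnth q i) | i < n].
have coord x y : tnth (T x) i <= tnth (T y) i + enorm (vsub x y).
  have := le_tnth_enorm (vsub (T x) (T y)) i; rewrite tnth_mktuple.
  by move=> /le_trans-/(_ _ (lipT x y)); rewrite ler_norml => /andP[_]; lra.
have -> : (@tnth n R ^~ i \o T) @^-1` `]-oo, c[ =
    \bigcup_(q : n.-tuple rat) [set x | tnth (T (r q)) i + enorm (vsub x (r q)) < c].
  apply/seteqP; split => x /=; rewrite in_itv/=.
    move=> Txc; have e0 : 0 < (c - tnth (T x) i) / 2 by lra.
    have [q qx] := ratr_tuple_dense x e0; exists q => //=.
    have := coord (r q) x.
    have -> : enorm (vsub (r q) x) = enorm (vsub x (r q)).
      congr Num.sqrt; apply: eq_bigr => j _; rewrite !tnth_mktuple.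
      by rewrite -sqrrN opprB.
    by move: qx; rewrite -/(r q); lra.
  by move=> [q _ /=]; apply: le_lt_trans; exact: coord.
apply: countable_bigcupT_measurable; first exact: countableP.
move=> q; rewrite -[X in measurable X]setTI.
rewrite (_ : [set x | _] = (fun x => tnth (T (r q)) i + enorm (vsub x (r q))) @^-1` `]-oo, c[).
  have m : measurable_fun setT (fun x => tnth (T (r q)) i + enorm (vsub x (r q))).
    apply: measurable_funD => //.
    rewrite (_ : (fun x => enorm _) = fun x => (dot (vsub x (r q)) (vsub x (r q))) `^ 2^-1).
      apply: (measurableT_comp (measurable_powR _)).
      under eq_fun do rewrite !dotE.
      have ml := measurable_dot (@measurable_id _ (n.-tuple R) setT) (@measurable_id _ (n.-tuple R) setT).
      have mc (y : n.-tuple R) : measurable_fun setT (fun x => dot x y).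
        by apply: measurable_dot => //; exact: measurable_cst.
      have mc' (y : n.-tuple R) : measurable_fun setT (dot y).
        by apply: measurable_dot => //; exact: measurable_cst.
      apply: measurable_funB; apply: measurable_funB => //.
    by apply/funext => x; rewrite powR12_sqrt ?dot_ge0.
  by apply: m => //; exact: measurable_itv.
by apply/seteqP; split => x /=; rewrite in_itv.
Qed.

End lipschitz_measurable.

(** * The density of a signal with independent Gaussian noise *)

Section noisy_density.
Context {R : realType} {n : nat} {d} {Omega : measurableType d}.
Variables (P : probability Omega R) (Z : {RV P >-> n.-tuple R}).
Local Open Scope ereal_scope.

Lemma gaussian_measure_distribution : standard_gaussian P Z ->
  gaussian_measure (distribution P Z).
Proof.
move=> [_ mg g0 ZE] F mF F0.
exact: (@ge0_integral_density _ _ _ (lebesgue_tuple n) (distribution P Z)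
  (@gaussian_density R n)).
Qed.

(** Independence determines the joint law. *)
Lemma independent_vectors_joint (Y : Omega -> n.-tuple R) (C : set (n.-tuple R * n.-tuple R)) :
  measurable_fun setT Y -> independent_vectors P Y Z -> measurable C ->
  P ((fun w => (Y w, Z w)) @^-1` C) =
  \int[P]_w \int[distribution P Z]_z (\1_C (Y w, z))%:E.
Proof.
move=> mY YZ mC.
pose mixinY := isMeasurableFun.Build _ _ _ _ Y mY.
pose Y' : {RV P >-> n.-tuple R} := HB.pack Y mixinY.
have mYZ : measurable_fun setT (fun w => (Y w, Z w)).
  by apply/measurable_fun_pairP; split.
pose mixinYZ := isMeasurableFun.Build _ _ _ _ _ mYZ.
pose YZ' : {RV P >-> (n.-tuple R * n.-tuple R)%type} :=
  HB.pack (fun w => (Y w, Z w)) mixinYZ.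
have E := @product_measure_unique _ _ _ _ R (distribution P Y') (distribution P Z)
  (distribution P YZ') YZ C mC.
transitivity (\int[distribution P Y' \x distribution P Z]_p (\1_C p)%:E).
  rewrite integral_indic// setIT; exact: esym E.
have mI : measurable_fun setT (fun p : n.-tuple R * n.-tuple R => (\1_C p : R)%:E).
  by apply/measurable_EFinP; exact: measurable_indic.
have I0 (p : n.-tuple R * n.-tuple R) : 0 <= (\1_C p : R)%:E by rewrite lee_fin indicE ler0n.
transitivity (\int[distribution P Y']_y \int[distribution P Z]_z (\1_C (y, z))%:E).
  exact: (@fubini_tonelli1 _ _ _ _ R (distribution P Y') (distribution P Z) _ mI I0).
rewrite /distribution ge0_integral_pushforward//.
- exact: (@measurable_fun_fubini_tonelli_F _ _ _ _ R (distribution P Z) _ mI I0).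
- by move=> y _; exact: integral_ge0.
Qed.

End noisy_density.

Section noisy_density.
Context {R : realType} {n : nat} {d} {Omega : measurableType d}.
Variables (P : probability Omega R) (Z : {RV P >-> n.-tuple R}) (s : R).
Hypothesis stdZ : standard_gaussian P Z.
Hypothesis s0 : 0 < s.
Implicit Types (Y : Omega -> n.-tuple R) (x y z : n.-tuple R).

Let G := distribution P Z.
Let gaussG : gaussian_measure G. Proof. exact: gaussian_measure_distribution. Qed.

Let sg := Num.sqrt s.
Let c := sg^-1.
Let sg0 : 0 < sg. Proof. by rewrite sqrtr_gt0. Qed.
Let c0 : 0 < c. Proof. by rewrite invr_gt0. Qed.
Let cN0 : c != 0. Proof. by rewrite gt_eqF. Qed.
Let sgN0 : sg != 0. Proof. by rewrite gt_eqF. Qed.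
Let sgc : sg * c = 1. Proof. by rewrite divff. Qed.

(** The signal rescaled so as to make the noise standard. *)
Definition normalized Y w := vscale (Num.sqrt s)^-1 (Y w).

(** The density of [Y + sqrt s * Z] when [Y] and [Z] are independent. *)
Definition noisy_density Y y : R :=
  (Num.sqrt s)^-1 ^+ n * (gaussian_density (vscale (Num.sqrt s)^-1 y) *
    mixture P (normalized Y) (vscale (Num.sqrt s)^-1 y)).

Lemma measurable_normalized Y : measurable_fun setT Y ->
  measurable_fun setT (normalized Y).
Proof. by move=> mY; apply: measurable_vscale => //; exact: measurable_cst. Qed.

Lemma measurable_scale (a : R) :
  measurable_fun setT (fun y : n.-tuple R => vscale a y).
Proof. by apply: measurable_vscale => //; exact: measurable_cst. Qed.

Lemma noisy_density_gt0 Y y : measurable_fun setT Y -> 0 < noisy_density Y y.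
Proof.
move=> mY; rewrite mulr_gt0 ?exprn_gt0// mulr_gt0 ?gaussian_density_gt0//.
by apply: mixture_gt0; exact: measurable_normalized.
Qed.

Lemma measurable_noisy_density Y : measurable_fun setT Y ->
  measurable_fun setT (noisy_density Y).
Proof.
move=> mY; apply: measurable_funM => //; apply: measurable_funM.
  by apply: measurable_gaussian_density; exact: measurable_scale.
have mm := measurable_mixture P (measurable_normalized mY).
exact: (measurableT_comp mm (measurable_scale c)).
Qed.

(** Given [Y = x], the vector [Y + sqrt s * Z] is Gaussian around [x]. *)
Lemma noisy_densityP Y : measurable_fun setT Y -> independent_vectors P Y Z ->
  has_density P (fun w => vadd (Y w) (vscale (Num.sqrt s) (Z w))) (noisy_density Y).
Proof.
move=> mY YZ; have mU := measurable_normalized mY.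
have mZ : measurable_fun setT Z by [].
split.
- by apply: measurable_vadd => //; exact: (measurableT_comp (measurable_scale _) mZ).
- exact: measurable_noisy_density.
- by move=> y; apply/ltW; exact: noisy_density_gt0.
move=> A mA; pose C := [set p : n.-tuple R * n.-tuple R | A (vadd p.1 (vscale sg p.2))].
have madd : measurable_fun setT
    (fun p : n.-tuple R * n.-tuple R => vadd p.1 (vscale sg p.2)).
  apply: measurable_vadd; first exact: measurable_fst.
  exact: (measurableT_comp (measurable_scale _) measurable_snd).
have mC : measurable C by rewrite -[C]setTI; exact: madd.
have mIA : measurable_fun setT (\1_A : _ -> R) by exact: measurable_indic.
have IA0 y : 0 <= (\1_A y : R) by rewrite indicE ler0n.
(* J w is the density of Y w + sg * Z, restricted to A. *)
pose J w y : \bar R := ((\1_A y)%:E * (gaussian_density (vscale c y) *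
   tilt (normalized Y w) (vscale c y) * c ^+ n)%:E)%E.
have J1 w y : 0 <= gaussian_density (vscale c y) *
    tilt (normalized Y w) (vscale c y) * c ^+ n.
  apply: mulr_ge0; last by rewrite exprn_ge0// ltW.
  by rewrite mulr_ge0 ?gaussian_density_ge0 ?tilt_ge0.
have J0 w y : (0 <= J w y)%E.
  by apply: mule_ge0; rewrite lee_fin//; exact: J1.
have mJ : measurable_fun setT (fun p : Omega * n.-tuple R => J p.1 p.2).
  have msc : measurable_fun setT (fun p : Omega * n.-tuple R => vscale c p.2).
    exact: (measurableT_comp (measurable_scale c) measurable_snd).
  apply: emeasurable_funM; apply/measurable_EFinP.
    exact: (measurableT_comp mIA measurable_snd).
  apply: measurable_funM => //; apply: measurable_funM.
    exact: measurable_gaussian_density.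
  apply: measurable_tilt => //; exact: (measurableT_comp mU measurable_fst).
transitivity (\int[P]_w \int[lebesgue_tuple n]_y J w y)%E.
  transitivity (\int[P]_w \int[G]_z (\1_C (Y w, z))%:E)%E.
    exact: (independent_vectors_joint mY YZ mC).
  apply: eq_integral => w _.
  have mIC : measurable_fun setT (fun z => (\1_C (Y w, z) : R)%:E).
    apply/measurable_EFinP.
    have mI : measurable_fun setT (\1_C : _ -> R) by exact: measurable_indic.
    exact: (measurable_fun_pair2 _ mI).
  have IC0 z : (0 <= (\1_C (Y w, z) : R)%:E)%E by rewrite lee_fin indicE ler0n.
  rewrite gaussG//.
  pose F z : \bar R := ((\1_C (Y w, z))%:E * (gaussian_density z)%:E)%E.
  have mF : measurable_fun setT F.
    by apply: emeasurable_funM => //; apply/measurable_EFinP; exact: measurable_gaussian_density.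
  have F0 z : (0 <= F z)%E by rewrite mule_ge0// lee_fin gaussian_density_ge0.
  rewrite -(ge0_integral_lebesgue_tuple_affine (vscale (-1) (normalized Y w)) cN0 mF F0).
  apply: eq_integral => y _; rewrite /F /J.
  have -> : vadd (vscale c y) (vscale (-1) (normalized Y w)) =
            vsub (vscale c y) (normalized Y w).
    by apply: eq_from_tnth => i; rewrite !tnth_mktuple mulN1r.
  have -> : \1_C (Y w, vsub (vscale c y) (normalized Y w)) = \1_A y :> R.
    rewrite !indicE; congr (_%:R); congr (nat_of_bool _).
    have E : vadd (Y w) (vscale sg (vsub (vscale c y) (normalized Y w))) = y.
      apply: eq_from_tnth => i; rewrite !tnth_mktuple -/c.
      have -> : tnth (Y w) i + sg * (c * tnth y i - c * tnth (Y w) i) =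
        tnth (Y w) i + (sg * c) * (tnth y i - tnth (Y w) i) by ring.
      by rewrite sgc; ring.
    by apply/idP/idP; rewrite !inE /C/= E.
  by rewrite gaussian_density_vsub gtr0_norm// -muleA -EFinM.
rewrite (@fubini_tonelli _ _ _ _ R P (lebesgue_tuple n) _ mJ)/=; last first.
  by move=> p; exact: J0.
rewrite [RHS]integral_mkcond; apply: eq_integral => y _.
rewrite /J ge0_integralZl_EFin//; last 2 first.
- by move=> w _; rewrite lee_fin; exact: J1.
- apply/measurable_EFinP; apply: measurable_funM => //; apply: measurable_funM => //.
  exact: measurable_tiltr.
have -> : (\int[P]_w (gaussian_density (vscale c y) *
   tilt (normalized Y w) (vscale c y) * c ^+ n)%:E = (noisy_density Y y)%:E)%E.
  transitivity (\int[P]_w ((c ^+ n * gaussian_density (vscale c y))%:E *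
     (tilt (normalized Y w) (vscale c y))%:E))%E.
    by apply: eq_integral => w _; rewrite -EFinM; congr (_%:E); ring.
  rewrite ge0_integralZl_EFin.
  - by rewrite -mixtureE// -EFinM -mulrA.
  - exact: measurableT.
  - by move=> w _; rewrite lee_fin tilt_ge0.
  - by apply/measurable_EFinP; exact: measurable_tiltr.
  - by rewrite mulr_ge0 ?gaussian_density_ge0// exprn_ge0// ltW.
rewrite /patch indicE; case: (y \in A); first by rewrite mul1e.
by rewrite mul0e.
Qed.

(** The maximum of the density of [sqrt s * Z]. *)
Definition noise_peak : R := (Num.sqrt s)^-1 ^+ n * (2 * pi) `^ (- n%:R / 2).

Lemma peak_ratio Y y :
  measurable_fun setT Y ->
  noise_peak / noisy_density Y y = expR (dot (vscale c y) (vscale c y) / 2) /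
    mixture P (normalized Y) (vscale c y).
Proof.
move=> mY; rewrite /noise_peak /noisy_density -/c gaussian_densityE.
rewrite (mulNr (dot _ _)) expRN; set z := vscale c y; set m := mixture _ _ _.
have m0 : m != 0 by rewrite gt_eqF// mixture_gt0//; exact: measurable_normalized.
have cn0 : c ^+ n != 0 by rewrite expf_neq0.
have K0 : (2 * pi) `^ (- n%:R / 2) != 0 :> R.
  by rewrite gt_eqF// powR_gt0// mulr_gt0// pi_gt0.
have E0 : expR (dot z z / 2) != 0 by rewrite gt_eqF// expR_gt0.
move: (expR _) E0 (_ `^ _) K0 (c ^+ n) cn0 => e e0 K K0 cn cn0.
by field; rewrite K0 e0 cn0 m0.
Qed.

Lemma mixture_le Y z : measurable_fun setT Y -> mixture P Y z <= expR (dot z z / 2).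
Proof.
move=> mY; rewrite -lee_fin mixtureE// -[leRHS](integral_probability_cst P).
apply: ge0_le_integral => //.
- by move=> w _; rewrite lee_fin tilt_ge0.
- by apply/measurable_EFinP; exact: measurable_tiltr.
- by move=> w _; rewrite lee_fin tilt_le.
Qed.

Lemma noisy_density_le Y y : measurable_fun setT Y -> noisy_density Y y <= noise_peak.
Proof.
move=> mY; have f0 := noisy_density_gt0 y mY.
rewrite -[leLHS]mul1r -ler_pdivlMr// peak_ratio// ler_pdivlMr ?mul1r.
  by apply: mixture_le; exact: measurable_normalized.
by apply: mixture_gt0; exact: measurable_normalized.
Qed.

(** The entropy of [Y + sqrt s * Z] relative to [noise_peak] is the information
    it carries about [Y], plus a term that does not depend on [Y]: the entropy
    of the noise, relative to its own maximum.  Both sides may be infinite. *)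
Lemma integral_relative_entropy_noisy Y : measurable_fun setT Y ->
  (\int[lebesgue_tuple n]_y
     (noisy_density Y y * ln (noise_peak / noisy_density Y y))%:E =
   \int[G]_z (dot z z / 2)%:E + gaussian_information P G (normalized Y))%E.
Proof.
move=> mY; have mU := measurable_normalized mY.
pose U := normalized Y; pose m := mixture P U.
have m0 z : 0 < m z by exact: mixture_gt0.
pose L z := ln (expR (dot z z / 2) / m z).
have L0 z : 0 <= L z.
  by rewrite ln_ge0// ler_pdivlMr// mul1r; exact: mixture_le.
have mm : measurable_fun setT m by exact: measurable_mixture.
have mdz : measurable_fun setT (fun z : n.-tuple R => dot z z / 2).
  by apply: measurable_funM => //; exact: measurable_dot.
have mL : measurable_fun setT L.
  rewrite (_ : L = fun z => dot z z / 2 - ln (m z)).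
    apply: measurable_funB => //; exact: (measurableT_comp (@measurable_ln R) mm).
  by apply/funext => z; rewrite /L ln_div ?posrE ?expR_gt0// expRK.
have step1 : (\int[lebesgue_tuple n]_y
     (noisy_density Y y * ln (noise_peak / noisy_density Y y))%:E =
    \int[G]_z (m z * L z)%:E)%E.
  have mB : measurable_fun setT (fun y =>
      (noisy_density Y y * ln (noise_peak / noisy_density Y y))%:E).
    apply/measurable_EFinP; apply: measurable_funM.
      exact: measurable_noisy_density.
    rewrite (_ : (fun _ => _) = fun y => L (vscale c y)).
      exact: (measurableT_comp mL (measurable_scale c)).
    by apply/funext => y; rewrite peak_ratio.
  have B0 y : (0 <= (noisy_density Y y * ln (noise_peak / noisy_density Y y))%:E)%E.
    rewrite lee_fin mulr_ge0 ?(ltW (noisy_density_gt0 _ _))// peak_ratio//.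
    exact: L0.
  pose o : n.-tuple R := [tuple 0 | i < n].
  rewrite -(ge0_integral_lebesgue_tuple_affine o sgN0 mB B0) gaussG//.
  - apply: eq_integral => z _.
    have -> : vadd (vscale sg z) o = vscale sg z.
      by apply: eq_from_tnth => i; rewrite !tnth_mktuple addr0.
    have scz : vscale c (vscale sg z) = z.
      by apply: eq_from_tnth => i; rewrite !tnth_mktuple mulrA mulVf// mul1r.
    rewrite peak_ratio// /noisy_density -/c scz -/(L z) -/(m z).
    rewrite gtr0_norm// -!EFinM; congr (_%:E).
    rewrite (_ : c ^+ n * (gaussian_density z * mixture P (normalized Y) z) *
        ln (expR (dot z z / 2) / mixture P (normalized Y) z) * sg ^+ n =
      (sg * c) ^+ n * (m z * L z * gaussian_density z)).
      by rewrite sgc expr1n mul1r.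
    by rewrite exprMn /L /m /U; move: (ln _) => l; ring.
  - by apply/measurable_EFinP; exact: measurable_funM.
  - by move=> z; rewrite lee_fin mulr_ge0// ltW.
have t0 w z : 0 <= tilt (U w) z by exact: tilt_ge0.
have m0' z : 0 <= m z by exact: ltW.
(* Given the signal U w, the entropy of the observation relative to the peak is
   that of the noise, Q w z being its integrand. *)
pose Q w z := dot (vsub z (U w)) (vsub z (U w)) / 2.
have Q0 w z : 0 <= Q w z by rewrite divr_ge0// dot_ge0.
have mQ w : measurable_fun setT (Q w).
  rewrite /Q; move: (U w) => a; under eq_fun do rewrite !dotE.
  have mx : measurable_fun setT (fun z => dot z a).
    by apply: measurable_dot => //; exact: measurable_cst.
  have mx' : measurable_fun setT (dot a).
    by apply: measurable_dot => //; exact: measurable_cst.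
  have mzz : measurable_fun setT (fun z : n.-tuple R => dot z z).
    by apply: measurable_dot; exact: measurable_id.
  apply: measurable_funM => //.
  apply: measurable_funB; first exact: measurable_funB.
  by apply: measurable_funB; [exact: mx'|exact: measurable_cst].
have mt w : measurable_fun setT (tilt (U w)) by exact: measurable_tiltl.
have k0 w z : (0 <= (kappa (tilt (U w) z) (m z))%:E)%E.
  by rewrite lee_fin kappa_ge0 ?tilt_gt0.
have mk w : measurable_fun setT (fun z => (kappa (tilt (U w) z) (m z))%:E).
  by apply/measurable_EFinP; apply: measurable_kappa.
have ident w z : tilt (U w) z * L z + m z =
    Q w z * tilt (U w) z + (kappa (tilt (U w) z) (m z) + tilt (U w) z).
  rewrite /kappa /L !ln_div ?posrE ?tilt_gt0 ?expR_gt0// expRK.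
  have -> : ln (tilt (U w) z) = dot (U w) z - dot (U w) (U w) / 2 by rewrite expRK.
  rewrite /Q; move: (U w) (m z) => a mz; move: (tilt a z) (ln mz) => e l.
  by rewrite !dotE (dotC z a); field.
have one_side w : (\int[G]_z (tilt (U w) z * L z + m z)%:E =
    \int[G]_z (dot z z / 2)%:E + (\int[G]_z (kappa (tilt (U w) z) (m z))%:E + 1))%E.
  transitivity (\int[G]_z ((Q w z)%:E * (tilt (U w) z)%:E +
      ((kappa (tilt (U w) z) (m z))%:E + (tilt (U w) z)%:E)))%E.
    by apply: eq_integral => z _; rewrite ident.
  have Qt0 z : (0 <= (Q w z)%:E * (tilt (U w) z)%:E)%E by rewrite -EFinM lee_fin mulr_ge0.
  have mtE : measurable_fun setT (fun z => (tilt (U w) z)%:E) by exact/measurable_EFinP.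
  have mQt : measurable_fun setT (fun z => (Q w z)%:E * (tilt (U w) z)%:E)%E.
    by apply: emeasurable_funM => //; exact/measurable_EFinP.
  have tE0 z : (0 <= (tilt (U w) z)%:E)%E by rewrite lee_fin.
  have kt0 z : (0 <= (kappa (tilt (U w) z) (m z))%:E + (tilt (U w) z)%:E)%E.
    exact: adde_ge0.
  have mkt : measurable_fun setT
      (fun z => (kappa (tilt (U w) z) (m z))%:E + (tilt (U w) z)%:E)%E.
    exact: emeasurable_funD.
  rewrite ge0_integralD// ge0_integralD//.
  rewrite integral_tilt//; congr (_ + _)%E.
  rewrite (ge0_integral_tilt gaussG); last 2 first.
  - exact/measurable_EFinP.
  - by move=> z; rewrite lee_fin.
  by apply: eq_integral => z _; rewrite /Q vaddK.
have mtp := measurable_tilt_pair mU.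
pose C0 := (\int[G]_z (dot z z / 2)%:E)%E.
have C00 : (0 <= C0)%E by apply: integral_ge0 => z _; rewrite lee_fin divr_ge0 ?dot_ge0.
have mKP := measurable_kappa_mixture P mU.
have swap : (\int[G]_z \int[P]_w (tilt (U w) z * L z + m z)%:E =
    \int[P]_w \int[G]_z (tilt (U w) z * L z + m z)%:E)%E.
  apply: (@fubini_tonelli _ _ _ _ R G P (fun p => (tilt (U p.2) p.1 * L p.1 + m p.1)%:E)).
  - apply/measurable_EFinP; apply: measurable_funD; last exact: (measurableT_comp mm measurable_fst).
    by apply: measurable_funM => //; exact: (measurableT_comp mL measurable_fst).
  - by move=> p; rewrite lee_fin addr_ge0 ?mulr_ge0.
have lhs : (\int[G]_z \int[P]_w (tilt (U w) z * L z + m z)%:E =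
    \int[G]_z (m z * L z)%:E + 1)%E.
  transitivity (\int[G]_z ((m z * L z)%:E + (m z)%:E))%E.
    apply: eq_integral => z _.
    transitivity (\int[P]_w ((L z)%:E * (tilt (U w) z)%:E + (m z)%:E))%E.
      by apply: eq_integral => w _; rewrite mulrC EFinD EFinM.
    have mtz : measurable_fun setT (fun w => (tilt (U w) z)%:E).
      by apply/measurable_EFinP; exact: measurable_tiltr.
    rewrite ge0_integralD//; last 3 first.
    - by move=> w _; rewrite mule_ge0 ?lee_fin.
    - exact: measurable_funeM.
    - by move=> w _; rewrite lee_fin.
    rewrite ge0_integralZl_EFin//; last by move=> w _; rewrite lee_fin.
    by rewrite -mixtureE// -EFinM mulrC integral_probability_cst.
  rewrite ge0_integralD//; last 4 first.
  - by move=> z _; rewrite lee_fin mulr_ge0.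
  - by apply/measurable_EFinP; exact: measurable_funM.
  - by move=> z _; rewrite lee_fin.
  - exact/measurable_EFinP.
  by rewrite integral_mixture.
have gen (x : \bar R) (h : Omega -> \bar R) : (0 <= x)%E -> measurable_fun setT h ->
    (forall w, 0 <= h w)%E ->
    (\int[P]_w (x + (h w + 1)) = x + \int[P]_w h w + 1)%E.
  move=> x0 mh h0; have h10 w : (0 <= h w + 1)%E by rewrite adde_ge0.
  have cstP (y : \bar R) : (\int[P]_w y = y)%E.
    rewrite integral_cst// -[RHS]mule1; congr (_ * _)%E; exact: probability_setT.
  rewrite ge0_integralD//; last exact: emeasurable_funD.
  by rewrite ge0_integralD// !cstP addeA.
have rhs : (\int[P]_w \int[G]_z (tilt (U w) z * L z + m z)%:E =
    C0 + gaussian_information P G U + 1)%E.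
  transitivity (\int[P]_w (C0 + (\int[G]_z (kappa (tilt (U w) z) (m z))%:E + 1)))%E.
    by apply: eq_integral => w _; rewrite one_side.
  have mD : measurable_fun setT (fun w => \int[G]_z (kappa (tilt (U w) z) (m z))%:E)%E.
    apply: (@measurable_fun_fubini_tonelli_G _ _ _ _ R G _ mKP) => p.
    by rewrite lee_fin kappa_ge0 ?tilt_gt0.
  have D0 w : (0 <= \int[G]_z (kappa (tilt (U w) z) (m z))%:E)%E.
    exact: integral_ge0.
  exact: (gen C0).
have aux (a b x y : \bar R) : (x = a + 1 -> x = y -> y = b + 1 -> a = b)%E.
  by move=> -> <-; exact: adde_fin_inj.
rewrite step1; exact: aux lhs swap rhs.
Qed.

End noisy_density.

(** * Entropy of a bounded density *)

Section bounded_density.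
Context {R : realType} {n : nat}.
Variables (f : n.-tuple R -> R) (M : R).
Hypothesis mf : measurable_fun setT f.
Hypothesis f0 : forall x, 0 < f x.
Hypothesis fM : forall x, f x <= M.
Local Open Scope ereal_scope.
Local Notation leb := (lebesgue_tuple n).
Hypothesis intf : \int[leb]_x (f x)%:E = 1.

Let f0' x : (0 <= f x)%R. Proof. exact: ltW. Qed.

Let mfE : measurable_fun setT (fun x => (f x)%:E).
Proof. exact/measurable_EFinP. Qed.

Let mflogf : measurable_fun setT (flogf f).
Proof. exact: measurable_flogf. Qed.

Let L := ln M.

Let fE0 x : 0 <= (f x)%:E.
Proof. by rewrite lee_fin. Qed.

Let integral_scale (a : R) : (0 <= a)%R -> \int[leb]_x (a%:E * (f x)%:E) = a%:E.
Proof. by move=> a0; rewrite ge0_integralZl_EFin// intf mule1. Qed.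

Let flogfE x : (f x * ln (f x) = f x * L - f x * ln (M / f x))%R.
Proof.
have M0 : (0 < M)%R by apply: lt_le_trans (fM x).
by rewrite ln_div ?posrE// mulrBr opprB addrC subrK.
Qed.

Let rel0 x : (0 <= f x * ln (M / f x))%R.
Proof. by rewrite mulr_ge0// ln_ge0// ler_pdivlMr// mul1r. Qed.

(** The positive part of [f log f] is at most [|ln M| f]. *)
Lemma integral_flogf_pos_lty : \int[leb]_x (flogf f)^\+ x < +oo.
Proof.
apply: (@le_lt_trans _ _ (\int[leb]_x (`|L|%:E * (f x)%:E))).
  apply: ge0_le_integral => //.
  - exact: measurable_funepos.
  - exact: measurable_funeM.
  move=> x _; rewrite funeposE ge_max; apply/andP; split; last exact: mule_ge0.
  rewrite /flogf -EFinM lee_fin flogfE; apply: (@le_trans _ _ (f x * L)%R); first by have := rel0 x; lra.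
  by rewrite mulrC ler_wpM2r// ler_norm.
by rewrite integral_scale// ltry.
Qed.

(** The entropy relative to the bound [M] is nonnegative, possibly infinite. *)
Lemma integral_flogfE : \int[leb]_x flogf f x =
  L%:E - \int[leb]_x (f x * ln (M / f x))%:E.
Proof.
pose B x : \bar R := (f x * ln (M / f x))%:E.
have B0 x : 0 <= B x by rewrite lee_fin.
have mB : measurable_fun setT B.
  rewrite (_ : B = fun x => (f x * L - f x * ln (f x))%:E); last first.
    by apply/funext => x; rewrite /B flogfE; congr (_%:E); ring.
  apply/measurable_EFinP; apply: measurable_funB; first exact: measurable_funM.
  by move/measurable_EFinP : mflogf.
have mp : measurable_fun setT (flogf f)^\+ by exact: measurable_funepos.
have mn : measurable_fun setT (flogf f)^\- by exact: measurable_funeneg.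
(* Positive and negative parts are separated in order to add nonnegative
   functions only; Lp and Ln are the parts of ln M. *)
have [Lp Lp0 [Ln Ln0 LE]] : exists2 a : R, (0 <= a)%R & exists2 b : R, (0 <= b)%R & (L = a - b)%R.
  have [L0|L0] := leP 0%R L; first by exists L => //; exists 0%R => //; rewrite subr0.
  by exists 0%R => //; exists (- L)%R; [rewrite oppr_ge0 ltW|rewrite sub0r opprK].
have mLf a : measurable_fun setT (fun x => a%:E * (f x)%:E) by exact: measurable_funeM.
have Lf0 (a : R) x : (0 <= a)%R -> 0 <= a%:E * (f x)%:E by move=> a0; rewrite mule_ge0.
have E : \int[leb]_x (flogf f)^\+ x + (Ln%:E + \int[leb]_x B x) =
         \int[leb]_x (flogf f)^\- x + Lp%:E.
  rewrite -(integral_scale Ln0) -(integral_scale Lp0).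
  rewrite -ge0_integralD//; last by move=> x _; exact: Lf0.
  rewrite -ge0_integralD//; last 2 first.
  - by move=> x _; rewrite adde_ge0// Lf0.
  - exact: emeasurable_funD.
  rewrite -ge0_integralD//; last by move=> x _; exact: Lf0.
  apply: eq_integral => x _.
  have := flogfE x; rewrite LE funeposE funenegE /flogf /B -!EFinM => h.
  rewrite -!EFinN /= -!EFin_max -!EFinD; congr (_%:E).
  rewrite /Num.max; case: ltP => ?; case: ltP => ?; lra.
rewrite integralE LE EFinB.
have := integral_flogf_pos_lty.
have : 0 <= \int[leb]_x (flogf f)^\+ x by exact: integral_ge0.
have : 0 <= \int[leb]_x (flogf f)^\- x by exact: integral_ge0.
have : 0 <= \int[leb]_x B x by exact: integral_ge0.
move: E; rewrite -/(\int[leb]_x B x).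
move: (\int[leb]_x (flogf f)^\+ x) (\int[leb]_x (flogf f)^\- x) (\int[leb]_x B x).
move=> [p| |] [q| |] [b| |] //= [E] _ _ _ _; rewrite -!EFinB; congr (_%:E); lra.
Qed.

End bounded_density.

Section entropy_of_noisy_vectors.
Context {R : realType} {n : nat} {d} {Omega : measurableType d}.
Variables (P : probability Omega R) (Z : {RV P >-> n.-tuple R}) (s : R).
Hypothesis stdZ : standard_gaussian P Z.
Hypothesis s0 : 0 < s.
Variable Y : Omega -> n.-tuple R.
Hypothesis mY : measurable_fun setT Y.
Hypothesis YZ : independent_vectors P Y Z.
Local Open Scope ereal_scope.

Let W w := vadd (Y w) (vscale (Num.sqrt s) (Z w)).
Let f := noisy_density P s Y.

Let Wf : has_density P W f. Proof. exact: noisy_densityP. Qed.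

Let mf : measurable_fun setT f. Proof. exact: measurable_noisy_density. Qed.

Let intf : \int[lebesgue_tuple n]_x (f x)%:E = 1.
Proof.
have [_ _ _ fE] := Wf; rewrite -fE// preimage_setT; exact: probability_setT.
Qed.

Let f0 x : (0 < f x)%R. Proof. exact: noisy_density_gt0. Qed.

Let fM x : (f x <= @noise_peak R n s)%R. Proof. exact: noisy_density_le. Qed.

Lemma entropy_exists_noisy : entropy_exists P W.
Proof.
split; first by exists f.
move=> g Wg; have [_ mg _ _] := Wg; split; first exact: measurable_flogf.
(* Another density g agrees with f almost everywhere. *)
left; apply: le_lt_trans (integral_flogf_pos_lty mf f0 fM intf).
rewrite le_eqVlt; apply/orP; left; apply/eqP.
apply: ge0_ae_eq_integral => //.
- by apply: measurable_funepos; exact: measurable_flogf.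
- by apply: measurable_funepos; exact: measurable_flogf.
apply: filterS (density_unique Wg Wf) => x /= /(_ I)[gf] _.
by rewrite !funeposE /flogf gf.
Qed.

Lemma entropy_noisy : entropy P W =
  \int[distribution P Z]_z (dot z z / 2)%:E +
  gaussian_information P (distribution P Z) (normalized s Y) -
  (ln (@noise_peak R n s))%:E.
Proof.
rewrite (entropyE Wf) (integral_flogfE mf f0 fM intf) oppeB; last first.
  exact: fin_num_adde_defr.
by rewrite (integral_relative_entropy_noisy stdZ s0 mY) [LHS]addeC.
Qed.

End entropy_of_noisy_vectors.

(** * Contractions decrease the entropy *)

Theorem theorem1p7 (R : realType) (n : nat)
    (d : measure_display) (Omega : measurableType d) (P : probability Omega R)
    (T : n.-tuple R -> n.-tuple R) (X Z : {RV P >-> n.-tuple R}) (s : R) :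
  one_lipschitz T ->
  standard_gaussian P Z ->
  independent_vectors P X Z ->
  0 < s ->
  let W1 := fun w => vadd (X w) (vscale (Num.sqrt s) (Z w)) in
  let W2 := fun w => vadd (T (X w)) (vscale (Num.sqrt s) (Z w)) in
  [/\ entropy_exists P W1, entropy_exists P W2,
      (-oo < entropy P W1)%E, (-oo < entropy P W2)%E &
      (entropy P W2 <= entropy P W1)%E].
Proof.
move=> lipT stdZ XZ s0 W1 W2.
have mT := measurable_one_lipschitz lipT.
have mX : measurable_fun setT X by [].
have mTX : measurable_fun setT (fun w => T (X w)) by exact: (measurableT_comp mT mX).
have TXZ : independent_vectors P (fun w => T (X w)) Z.
  move=> A B mA mB; have mTA : measurable (T @^-1` A) by rewrite -[_ @^-1` _]setTI; exact: mT.
  exact: XZ _ _ mTA mB.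
have E1 : entropy P W1 = _ := entropy_noisy stdZ s0 mX XZ.
have E2 : entropy P W2 = _ := entropy_noisy stdZ s0 mTX TXZ.
have gaussG := gaussian_measure_distribution stdZ.
have C0 : (0 <= \int[distribution P Z]_z (dot z z / 2)%:E)%E.
  by apply: integral_ge0 => z _; rewrite lee_fin divr_ge0 ?dot_ge0.
have info0 (Y : Omega -> n.-tuple R) : measurable_fun setT Y ->
    (0 <= gaussian_information P (distribution P Z) (normalized s Y))%E.
  move=> mY; apply: integral_ge0 => w _; apply: integral_ge0 => z _.
  rewrite lee_fin kappa_ge0 ?tilt_gt0// mixture_gt0//.
  exact: measurable_normalized.
have lt_aux (a b : \bar R) (c : R) : (0 <= a -> 0 <= b -> -oo < a + b - c%:E)%E.
  move=> a0 b0; apply: (@lt_le_trans _ _ (0 - c%:E)%E).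
    by rewrite add0e -EFinN ltNyr.
  by apply: leeD2r; exact: adde_ge0.
split.
- exact: (entropy_exists_noisy stdZ s0 mX XZ).
- exact: (entropy_exists_noisy stdZ s0 mTX TXZ).
- by rewrite E1; apply: lt_aux => //; exact: info0.
- by rewrite E2; apply: lt_aux => //; exact: info0.
rewrite E1 E2; apply: leeD2r; apply: leeD2l.
apply: (gaussian_information_contraction P gaussG).
- exact: measurable_normalized.
- exact: measurable_normalized.
move=> w w'; rewrite /normalized.
have subE (x y : n.-tuple R) (a : R) : dot (vsub (vscale a x) (vscale a y))
    (vsub (vscale a x) (vscale a y)) = a ^+ 2 * dot (vsub x y) (vsub x y).
  by rewrite !dotE; ring.
rewrite !subE; apply: ler_wpM2l; first exact: sqr_ge0.
exact: one_lipschitz_dot.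
Qed.
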